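(* Let $\Gamma$ and $\widetilde\Gamma$ be the graphs described in the context, with all edges of weight $1$. Then $$\sigma(H_\Gamma)=[-2,2]\cup\{\tfrac{17}{4}\},\qquad \sigma(H_{\widetilde\Gamma})=\left[-\tfrac{13\sqrt3}{6},\tfrac{13\sqrt3}{6}\right].$$ In particular, $\sigma(H_\Gamma)$ is not a subset of $\sigma(H_{\widetilde\Gamma})$.
   Context: $\Gamma_{\mathbb N}$ is the graph with vertex set $\mathbb N=\{1,2,\dots\}$ in which $i,k$ are joined by an edge iff $|i-k|=1$. $\Gamma$ is obtained from $\Gamma_{\mathbb N}$ by adding two loops at the vertex $1$. $T_4$ is the infinite 4-regular tree, and $\widetilde\Gamma$ is obtained by attaching to every vertex of $T_4$ its own copy of $\Gamma_{\mathbb N}$, identifying the vertex $1$ of the copy with that vertex of $T_4$. (The map sending each vertex of $T_4$ to $1$ and each copy of $\Gamma_{\mathbb N}$ identically onto $\Gamma_{\mathbb N}\subset\Gamma$ is a covering $\widetilde\Gamma\to\Gamma$.) For a weighted graph $\Omega$ (each edge, including each loop, gives rise to two directed edges, each with a weight $\omega_e$), the Laplace type operator $H_\Omega$ on $\ell^2$ of the vertex set is $(H_\Omega f)(v)=\sum_e\omega_ef(i_e)$, the sum over directed edges $e$ ending at $v$, with $i_e$ the initial vertex of $e$. With all weights $1$: $(H_\Gamma f)(1)=4f(1)+f(2)$, $(H_\Gamma f)(j)=f(j-1)+f(j+1)$ for $j\ge2$, and $H_{\widetilde\Gamma}$ is the adjacency operator of $\widetilde\Gamma$. $\sigma(\cdot)$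 denotes the spectrum. *)

(* Defs.v *)
(* The field of complex numbers is R[i], for R : realType. *)
From HB Require Import structures.
From mathcomp Require Import all_boot all_order all_algebra.
From mathcomp Require Import complex.
From mathcomp Require Import all_classical all_reals all_analysis.
From mathcomp Require Import zify ring.

Set Implicit Arguments.
Unset Strict Implicit.
Unset Printing Implicit Defensive.

Import Order.TTheory GRing.Theory Num.Theory.
Local Open Scope classical_set_scope.
Local Open Scope ring_scope.
Local Open Scope complex_scope.

(* An undirected edge, loop or not, is an orbit {e, flip e} of the fixed-point
   free involution flip, hence contributes exactly two directed edges (darts). *)
Record graph := Graph {
  vertex : choiceType;
  dart : choiceType;
  init : dart -> vertex;
  term : dart -> vertex;
  flip : dart -> dart;
  flipK : involutive flip;
  flip_neq : forall e, flip e != e;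
  init_flip : forall e, init (flip e) = term e }.

Section SimpleGraph.
Variables (V : choiceType) (adj : rel V).
Hypotheses (adj_sym : symmetric adj) (adj_irr : irreflexive adj).

Definition simple_dart := {p : V * V | adj p.1 p.2}.

Lemma simple_flip_subproof (e : simple_dart) : adj (val e).2 (val e).1.
Proof. by rewrite adj_sym (valP e). Qed.

Definition simple_flip (e : simple_dart) : simple_dart :=
  exist (fun p : V * V => adj p.1 p.2) ((val e).2, (val e).1)
    (simple_flip_subproof e).

Lemma simple_flipK : involutive simple_flip.
Proof. by move=> e; apply: val_inj; case: e => -[]. Qed.

Lemma simple_flip_neq e : simple_flip e != e.
Proof.
apply/eqP => /(congr1 val); case: e => -[x y] /= xy [yx _].
by move: xy; rewrite yx adj_irr.
Qed.

Definition simple_graph : graph :=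
  @Graph V simple_dart (fun e => (val e).1) (fun e => (val e).2) simple_flip
    simple_flipK simple_flip_neq (fun=> erefl).

End SimpleGraph.

Section AddLoops.
Variables (G : graph) (v : vertex G) (n : nat).

Definition loops_dart := (dart G + 'I_n * bool)%type.

Definition loops_flip (e : loops_dart) : loops_dart :=
  match e with inl e => inl (flip e) | inr (i, b) => inr (i, ~~ b) end.

Lemma loops_flipK : involutive loops_flip.
Proof. by case=> [e|[i b]] /=; rewrite ?flipK ?negbK. Qed.

Lemma loops_flip_neq e : loops_flip e != e.
Proof.
case: e => [e|[i b]]; apply/eqP => -[]; first by apply/eqP/flip_neq.
by case: b.
Qed.

Definition loops_init (e : loops_dart) := if e is inl e then init e else v.
Definition loops_term (e : loops_dart) := if e is inl e then term e else v.

Lemma loops_init_flip e : loops_init (loops_flip e) = loops_term e.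
Proof. by case: e => [e|[i b]] //=; rewrite init_flip. Qed.

Definition add_loops : graph :=
  @Graph (vertex G) loops_dart loops_init loops_term loops_flip
    loops_flipK loops_flip_neq loops_init_flip.

End AddLoops.

(* Every vertex x of G receives its own copy {x} * F of F, whose root (x, r)
   is identified with x. *)
Section Attach.
Variables (G F : graph) (r : vertex F).

Definition attach_dart := (dart G + vertex G * dart F)%type.

Definition attach_init (e : attach_dart) : vertex G * vertex F :=
  match e with inl e => (init e, r) | inr (x, e) => (x, init e) end.

Definition attach_term (e : attach_dart) : vertex G * vertex F :=
  match e with inl e => (term e, r) | inr (x, e) => (x, term e) end.

Definition attach_flip (e : attach_dart) : attach_dart :=
  match e with inl e => inl (flip e) | inr (x, e) => inr (x, flip e) end.

Lemma attach_flipK : involutive attach_flip.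
Proof. by case=> [e|[x e]] /=; rewrite flipK. Qed.

Lemma attach_flip_neq e : attach_flip e != e.
Proof.
by case: e => [e|[x e]]; apply/eqP => -[]; apply/eqP/flip_neq.
Qed.

Lemma attach_init_flip e : attach_init (attach_flip e) = attach_term e.
Proof. by case: e => [e|[x e]] /=; rewrite init_flip. Qed.

Definition attach : graph :=
  @Graph (vertex G * vertex F)%type attach_dart attach_init attach_term
    attach_flip attach_flipK attach_flip_neq attach_init_flip.

End Attach.

(* The vertex n + 1 of the half-line on {1, 2, ...} is encoded by n : nat. *)
Definition line_adj : rel nat := fun i k => (k == i.+1) || (i == k.+1).

Lemma line_adj_sym : symmetric line_adj.
Proof. by move=> i k; rewrite /line_adj orbC. Qed.

Lemma line_adj_irr : irreflexive line_adj.
Proof. by move=> i; rewrite /line_adj; lia. Qed.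

Definition GammaN : graph := simple_graph line_adj_sym line_adj_irr.

Definition Gamma : graph := add_loops (0%N : vertex GammaN) 2.

(* T_4 is realized as the Cayley graph of the free product of four copies of
   Z/2: the vertices are the words on four letters without two equal
   consecutive letters, and neighbours differ by one letter at the head.
   The lemmas T4_regular, T4_connected and T4_acyclic below characterize this
   graph up to isomorphism. *)
Definition reduced (w : seq 'I_4) : bool := sorted (fun a b => a != b) w.

Definition T4_vertex := {w : seq 'I_4 | reduced w}.

Definition T4_child (u v : T4_vertex) : bool :=
  [exists a : 'I_4, val v == a :: val u].

Definition T4_adj : rel T4_vertex := fun u v => T4_child u v || T4_child v u.

Lemma T4_childP u v : reflect (exists a, val v = a :: val u) (T4_child u v).
Proof. exact: 'exists_eqP. Qed.

Lemma T4_child_size u v : T4_child u v -> size (val v) = (size (val u)).+1.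
Proof. by case/T4_childP => a ->. Qed.

Lemma T4_adj_sym : symmetric T4_adj.
Proof. by move=> u v; rewrite /T4_adj orbC. Qed.

Lemma T4_adj_irr : irreflexive T4_adj.
Proof.
by move=> u; rewrite /T4_adj orbb; apply/negbTE/negP => /T4_child_size; lia.
Qed.

Definition T4 : graph := simple_graph T4_adj_sym T4_adj_irr.

Lemma T4_child_inj u1 u2 v : T4_child u1 v -> T4_child u2 v -> u1 = u2.
Proof.
by move=> /T4_childP[a va] /T4_childP[b]; rewrite va => -[_ /val_inj].
Qed.

Definition T4_move (a : 'I_4) (w : seq 'I_4) :=
  if w is b :: w' then if a == b then w' else a :: w else [:: a].

Lemma T4_move_reduced a w : reduced w -> reduced (T4_move a w).
Proof.
case: w => [//|b w] rw /=; case: eqVneq => ab; first exact: path_sorted rw.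
by rewrite /reduced /= ab.
Qed.

Definition T4_nbr (u : T4_vertex) (a : 'I_4) : T4_vertex :=
  exist _ (T4_move a (val u)) (T4_move_reduced a (valP u)).

Lemma val_T4_nbr u a : val (T4_nbr u a) = T4_move a (val u).
Proof. by []. Qed.

Lemma T4_regular u :
  injective (T4_nbr u) /\ (forall v, T4_adj u v <-> exists a, v = T4_nbr u a).
Proof.
split.
  move=> a b /(congr1 val); rewrite !val_T4_nbr; case: (val u) => [[]//|c w] /=.
  have [->|ac] := eqVneq a c; have [->|bc] := eqVneq b c => //.
  - by move=> /(congr1 size) /=; lia.
  - by move=> /(congr1 size) /=; lia.
  - by case.
move=> v; split.
  case/orP => /T4_childP[a e]; exists a; apply: val_inj; rewrite val_T4_nbr.
    case: (val u) (valP v) e => [|b w] rv e; first exact: e.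
    rewrite /=; have [ab|_] := eqVneq a b; last exact: e.
    by move: rv; rewrite e ab /reduced /= eqxx.
  by rewrite e /= eqxx.
case=> a ->; rewrite /T4_adj /T4_child val_T4_nbr.
case: (val u) => [|b w] /=; first by apply/orP; left; apply/existsP; exists a.
case: eqVneq => ab; apply/orP; [right|left]; apply/existsP.
  by exists b.
by exists a.
Qed.

Lemma T4_connected u v : exists2 p, path T4_adj u p & v = last u p.
Proof.
pose o : T4_vertex := exist _ [::] isT.
have from_o w : exists2 p, path T4_adj o p & w = last o p.
  case: w => w; elim: w => [|a w IHw] rw.
    by exists [::] => //; apply: val_inj.
  have rw' : reduced w := path_sorted rw.
  have [p op wp] := IHw rw'; exists (rcons p (exist _ (a :: w) rw)).
    rewrite rcons_path op -wp /=; apply/orP; left; apply/T4_childP.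
    by exists a.
  by rewrite last_rcons.
have [p op up] := from_o u; have [q oq vq] := from_o v.
exists (rev (belast o p) ++ q).
  rewrite cat_path; apply/andP; split.
    rewrite up rev_path; apply: sub_path op => x y.
    by rewrite T4_adj_sym.
  case: p up {op} => [|x p] /= -> //.
  by rewrite rev_cons last_rcons.
rewrite last_cat vq; congr last.
case: p up {op} => [|x p] /= -> //.
by rewrite rev_cons last_rcons.
Qed.

Lemma T4_acyclic (c : seq T4_vertex) :
  (2 < size c)%N -> uniq c -> ~~ cycle T4_adj c.
Proof.
move=> c3 cu; apply/negP => cc.
have [x xc xmax] : exists2 x, x \in c &
    forall y, y \in c -> (size (val y) <= size (val x))%N.
  case: c c3 {cu cc} => [//|x c] _; elim: c x => [|y c IHc] x.
    by exists x => [|y]; rewrite inE // => /eqP ->.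
  have [z zc zmax] := IHc y.
  have [xz|zx] := leqP (size (val x)) (size (val z)).
    exists z => [|t]; first by rewrite inE zc orbT.
    by rewrite inE => /predU1P[->|/zmax].
  exists x => [|t]; first by rewrite inE eqxx.
  by rewrite inE => /predU1P[->//|/zmax tz]; apply: leq_trans tz (ltnW zx).
have parent y : y \in c -> T4_adj x y -> T4_child y x.
  by move=> /xmax yx /orP[/T4_child_size sy|//]; rewrite sy ltnn in yx.
have [i c' rc] := rot_to xc.
have memc y : y \in c' -> y \in c.
  by move=> yc'; rewrite -(mem_rot i) rc inE yc' orbT.
move: cu cc c3; rewrite -(rot_uniq i) -(rot_cycle i) -(size_rot i) rc.
case: c' {rc} memc => [//|y c'] memc; case/lastP: c' memc => [//|c' z] memc.
rewrite /= => /and3P[_ yz _] /andP[xy]; rewrite rcons_path last_rcons.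
move=> /andP[_ zx] _; move: yz.
rewrite (T4_child_inj (parent y _ xy) (parent z _ _)) ?mem_rcons ?mem_head //.
- by apply: memc; rewrite inE eqxx.
- by apply: memc; rewrite inE mem_rcons inE eqxx orbT.
- by rewrite T4_adj_sym.
Qed.

Definition GammaTilde : graph := attach T4 (0%N : vertex GammaN).

Section Laplace.
Variable R : realType.

(* The sum over the darts ending at v has finitely many terms when the graph
   is locally finite, as in all graphs considered here. *)
Definition laplace (G : graph) (w : dart G -> R[i]) (f : vertex G -> R[i]) :
    vertex G -> R[i] :=
  fun v => \sum_(e \in [set e | term e = v]) w e * f (init e).

Lemma laplace_seq (G : graph) (w : dart G -> R[i]) f v (s : seq (dart G)) :
  uniq s -> (forall e, term e = v <-> e \in s) ->
  laplace w f v = \sum_(e <- s) w e * f (init e).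
Proof.
move=> us sP; rewrite /laplace [RHS]fsbig_seq //.
suff -> : [set e : dart G | term e = v] = [set` s] by [].
by apply/funext => e; apply/propext; exact: sP.
Qed.

Lemma laplace_Gamma0 (f : nat -> R[i]) :
  @laplace Gamma (fun=> 1) f 0%N = 4 * f 0%N + f 1%N.
Proof.
pose e10 : dart GammaN := exist (fun p => line_adj p.1 p.2) (1, 0)%N isT.
rewrite (@laplace_seq Gamma _ _ _ [:: inl e10; inr (ord0, true);
  inr (ord0, false); inr (ord_max, true); inr (ord_max, false)]).
- by rewrite !big_cons big_nil /=; ring.
- by [].
case=> [[[i k] ik]|[i b]] /=; rewrite !inE; split => //.
- move=> /= k0; apply/orP; left; apply/eqP; congr inl; apply: val_inj => /=.
  by move: ik; rewrite k0 /line_adj /= => /eqP ->.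
- by rewrite !orbF => /eqP[_ ->].
- by move=> _; case: i => [[|[|i]]] // i2; case: b.
Qed.

Lemma laplace_GammaS (f : nat -> R[i]) (j : nat) :
  @laplace Gamma (fun=> 1) f j.+1 = f j + f j.+2.
Proof.
have ha : line_adj j j.+1 by rewrite /line_adj eqxx.
have hb : line_adj j.+2 j.+1 by rewrite /line_adj eqxx orbT.
pose ea : dart GammaN := exist (fun p => line_adj p.1 p.2) (j, j.+1) ha.
pose eb : dart GammaN := exist (fun p => line_adj p.1 p.2) (j.+2, j.+1) hb.
rewrite (@laplace_seq Gamma _ _ _ [:: inl ea; inl eb]).
- by rewrite !big_cons big_nil /= !mul1r addr0.
- rewrite /= inE andbT; apply/eqP => -[]; lia.
case=> [[[i k] ik]|[i b]] /=; rewrite !inE; split => //.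
- move=> /= kj; subst k; have /orP[/= /eqP h|/= /eqP h] := ik.
    apply/orP; left; apply/eqP; congr inl; apply: val_inj => /=.
    by case: h => <-.
  by apply/orP; right; apply/eqP; congr inl; apply: val_inj => /=; rewrite h.
- by case/orP => /eqP[_ ->].
Qed.

End Laplace.

Section Spectrum.
Variables (R : realType) (V : choiceType).
Implicit Types (f g : V -> R[i]) (A B : (V -> R[i]) -> V -> R[i]).

Definition sqnorm f : \bar R :=
  \esum_(v in [set: V]) ((Normc.normc (f v) ^+ 2)%:E).

Definition l2 : set (V -> R[i]) := [set f | (sqnorm f < +oo)%E].

Definition l2norm f : R := Num.sqrt (fine (sqnorm f)).

(* Operators on l2 are given by functions on V -> R[i], of which only the
   restriction to l2 matters. *)
Definition bounded_operator A : Prop :=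
  [/\ forall f, l2 f -> l2 (A f),
      forall (a : R[i]) f g, l2 f -> l2 g ->
        A (a \*o f + g) = a \*o A f + A g
    & exists M : R, forall f, l2 f -> l2norm (A f) <= M * l2norm f].

Definition resolvent_set A : set R[i] :=
  [set z | exists2 B, bounded_operator B &
    forall f, l2 f -> A (B f) - z \*o B f = f /\ B (A f - z \*o f) = f].

Definition spectrum A : set R[i] := ~` resolvent_set A.

End Spectrum.

(* Main.v *)
(* The adjacency operator of a locally finite graph is self-adjoint, and a
   positive weight [h] with [sum_(u ~ v) h u <= M h v] bounds its norm by [M]
   (Schur test), so its spectrum lies in [[-M, M]].
   - For [GammaTilde] the weight [3^(-|x|/2) s^n] with [s = 1 / (2 sqrt 3)]
     gives the sharp constant [M = 2 sqrt 3 + s = 13 sqrt 3 / 6].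
   - For [Gamma] the weight [1] on the half-line gives [2], and the loops are a
     rank-one perturbation, which adds the single eigenvalue [17 / 4].
   Conversely, a real [z] in the claimed spectrum is not in the resolvent set
   because [(H - z) g = delta] has no solution in l2: along each half-line [g]
   satisfies [g (n + 2) = z g (n + 1) - g n], and decay forces [g = 0] when
   [|z| <= 2] and [g 1 = t g 0] when [z = t + 1/t], [|t| < 1].  On the tree this
   leaves the equation [A g = (1/t) g + delta], and summing over the spheres
   turns it into a recurrence of the same kind. *)
Require Import Defs.
From mathcomp Require Import all_boot all_order all_algebra.
From mathcomp Require Import complex.
From mathcomp Require Import all_classical all_reals all_analysis.
From mathcomp Require Import zify ring lra.

Set Implicit Arguments.
Unset Strict Implicit.
Unset Printing Implicit Defensive.

Import Order.TTheory GRing.Theory Num.Theory.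
Import numFieldNormedType.Exports.
Local Open Scope classical_set_scope.
Local Open Scope ring_scope.
Local Open Scope complex_scope.

(** * Square-summable functions *)

Section L2.
Variables (R : realType) (V : choiceType).
Implicit Types (f g : V -> R[i]) (z : R[i]).
Local Notation normc := (@Normc.normc R).

Lemma normc_ge0 z : 0 <= normc z.
Proof. by case: z => a b; exact: sqrtr_ge0. Qed.

Lemma sqr_normcE z : normc z ^+ 2 = complex.Re z ^+ 2 + complex.Im z ^+ 2.
Proof. by case: z => a b; rewrite sqr_sqrtr // addr_ge0 ?sqr_ge0. Qed.

Lemma normc_real (x : R) : normc x%:C = `|x|.
Proof. by rewrite /Normc.normc /= expr0n addr0 sqrtr_sqr. Qed.

Lemma normc_opp z : normc (- z) = normc z.
Proof. exact: normcN. Qed.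

Lemma ReB (z w : R[i]) : complex.Re (z - w) = complex.Re z - complex.Re w.
Proof. by case: z w => [a b] [c d]. Qed.

Lemma ImB (z w : R[i]) : complex.Im (z - w) = complex.Im z - complex.Im w.
Proof. by case: z w => [a b] [c d]. Qed.

Lemma Re_le_normc z : `|complex.Re z| <= normc z.
Proof.
rewrite -ler_sqr ?nnegrE ?normc_ge0 // sqr_normcE real_normK ?num_real //.
by rewrite lerDl sqr_ge0.
Qed.

Lemma Im_le_normc z : `|complex.Im z| <= normc z.
Proof.
rewrite -ler_sqr ?nnegrE ?normc_ge0 // sqr_normcE real_normK ?num_real //.
by rewrite lerDr sqr_ge0.
Qed.

Lemma esumZl (T : choiceType) (c : R) (F : T -> R) : 0 <= c ->
  (forall v, 0 <= F v) ->
  (\esum_(v in [set: T]) (c * F v)%:E =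
   c%:E * \esum_(v in [set: T]) (F v)%:E)%E.
Proof.
move=> c0 F0.
have [->|cn0] := eqVneq c 0.
  by rewrite mul0e; apply: esum1 => v _; rewrite mul0r.
have cp : 0 < c by rewrite lt0r cn0.
rewrite /esum -ereal_sup_pZl//; congr ereal_sup; apply/seteqP; split.
  move=> _ [X [fX XT] <-] /=; exists (\sum_(v \in X) (F v)%:E)%E.
    by exists X.
  rewrite !fsbig_finite//= ge0_sume_distrr => [|i _]; last by rewrite lee_fin.
  by apply: eq_bigr => i _; rewrite EFinM.
move=> _ [_ [X [fX XT] <-] <-] /=; exists X => //.
rewrite !fsbig_finite//= ge0_sume_distrr => [|i _]; last by rewrite lee_fin.
by apply: eq_bigr => i _; rewrite EFinM.
Qed.

Lemma sqnorm_ge0 f : (0 <= sqnorm f)%E.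
Proof. by apply: esum_ge0 => v _; rewrite lee_fin sqr_ge0. Qed.

Lemma l2norm_ge0 f : 0 <= l2norm f.
Proof. exact: sqrtr_ge0. Qed.

Lemma sqnormE f : l2 f -> sqnorm f = (l2norm f ^+ 2)%:E.
Proof.
move=> lf; rewrite /l2norm sqr_sqrtr; last by rewrite fine_ge0 ?sqnorm_ge0.
by rewrite fineK // ge0_fin_numE ?sqnorm_ge0.
Qed.

Lemma sqnorm_le f c : 0 <= c -> (sqnorm f <= (c ^+ 2)%:E)%E ->
  l2 f /\ l2norm f <= c.
Proof.
move=> c0 fc; have lf : l2 f by apply: le_lt_trans fc (ltry _).
split=> //; move: fc; rewrite sqnormE // lee_fin ler_sqr ?nnegrE //.
exact: l2norm_ge0.
Qed.

Lemma finsum_le_l2norm f (s : seq V) : l2 f -> uniq s ->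
  \sum_(v <- s) normc (f v) ^+ 2 <= l2norm f ^+ 2.
Proof.
move=> lf us; rewrite -lee_fin -sqnormE // -sumEFin.
rewrite fsbig_seq //.
by apply: esum_ge; exists [set` s] => //; split => //; exact: finite_seq.
Qed.

(** The sum over [V] is the supremum of its finite partial sums, so norm bounds can be checked on
    finite lists without repetition. *)
Lemma sqnorm_le_finsum f c :
  (forall s : seq V, uniq s -> \sum_(v <- s) normc (f v) ^+ 2 <= c) ->
  (sqnorm f <= c%:E)%E.
Proof.
move=> H; apply: ge_ereal_sup => _ [X [fX _] <-].
by rewrite fsbig_finite //= sumEFin lee_fin H // finmap.fset_uniq.
Qed.

Lemma normc_le_l2norm f v : l2 f -> normc (f v) <= l2norm f.
Proof.
move=> lf; rewrite -ler_sqr ?nnegrE ?normc_ge0 ?l2norm_ge0 //.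
by have := @finsum_le_l2norm f [:: v] lf isT; rewrite big_seq1.
Qed.

Lemma l2norm_le0 f : l2 f -> l2norm f <= 0 -> f = 0.
Proof.
move=> lf f0; apply/funext => v; apply: Normc.eq0_normc; apply/eqP.
by rewrite eq_le normc_ge0 andbT (le_trans (normc_le_l2norm v lf)).
Qed.

Lemma sqnorm0 : sqnorm (0 : V -> R[i]) = 0%E.
Proof. by apply: esum1 => v _; rewrite Normc.normc0 expr0n. Qed.

Lemma l2_0 : l2 (0 : V -> R[i]).
Proof. by rewrite /l2 /= sqnorm0. Qed.

Lemma l2norm0 : l2norm (0 : V -> R[i]) = 0.
Proof. by rewrite /l2norm sqnorm0 sqrtr0. Qed.

Lemma sqnormZ z f : sqnorm (z \*o f) = ((normc z ^+ 2)%:E * sqnorm f)%E.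
Proof.
rewrite -esumZl ?sqr_ge0 // => [|v]; last exact: sqr_ge0.
by apply: eq_esum => v _ /=; rewrite Normc.normcM exprMn.
Qed.

Lemma l2Z z f : l2 f -> l2 (z \*o f).
Proof. by move=> lf; rewrite /l2 /= sqnormZ sqnormE // -EFinM ltry. Qed.

Lemma l2normZ z f : l2 f -> l2norm (z \*o f) = normc z * l2norm f.
Proof.
move=> lf; rewrite {1}/l2norm sqnormZ sqnormE // -EFinM /= -exprMn sqrtr_sqr.
by rewrite ger0_norm // mulr_ge0 ?normc_ge0 ?l2norm_ge0.
Qed.

(** With [a] and [b] the two norms, (x + y)^2 <= (1 + b/a) x^2 + (1 + a/b) y^2 holds pointwise, and
    the right-hand side sums to exactly (a + b)^2. *)
Lemma l2_normD_le f g : l2 f -> l2 g ->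
  l2 (f + g) /\ l2norm (f + g) <= l2norm f + l2norm g.
Proof.
move=> lf lg.
have [f0|f0] := eqVneq (l2norm f) 0.
  by rewrite f0 (l2norm_le0 lf) ?f0 // add0r add0r.
have [g0|g0] := eqVneq (l2norm g) 0.
  by rewrite g0 (l2norm_le0 lg) ?g0 // !addr0.
have fp : 0 < l2norm f by rewrite lt0r f0 l2norm_ge0.
have gp : 0 < l2norm g by rewrite lt0r g0 l2norm_ge0.
apply: sqnorm_le; first by rewrite addr_ge0 ?l2norm_ge0.
set a := l2norm f in fp *; set b := l2norm g in gp *.
have -> : (((a + b) ^+ 2)%:E =
   (1 + b / a)%:E * sqnorm f + (1 + a / b)%:E * sqnorm g)%E.
  rewrite !sqnormE // -!EFinM -EFinD; congr EFin; rewrite -/a -/b.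
  by field; rewrite !gt_eqF.
have ab : 0 < b / a by rewrite divr_gt0.
have ba : 0 < a / b by rewrite divr_gt0.
rewrite -!esumZl; try by [move=> v; exact: sqr_ge0|rewrite addr_ge0 // ltW].
rewrite -esumD; try by move=> v _; rewrite lee_fin mulr_ge0 ?sqr_ge0 // addr_ge0 // ltW.
apply: le_esum => v _; rewrite -EFinD lee_fin.
set x := normc (f v); set y := normc (g v).
apply: (@le_trans _ _ ((x + y) ^+ 2)).
  by rewrite ler_sqr ?nnegrE ?addr_ge0 ?normc_ge0 //; exact: le_normcD.
rewrite -subr_ge0.
have -> : (1 + b / a) * x ^+ 2 + (1 + a / b) * y ^+ 2 - (x + y) ^+ 2 =
   (b * x - a * y) ^+ 2 / (a * b).
  by field; rewrite !gt_eqF.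
by rewrite mulr_ge0 ?sqr_ge0 // invr_ge0 ltW // mulr_gt0.
Qed.

Lemma l2D f g : l2 f -> l2 g -> l2 (f + g).
Proof. by move=> lf lg; case: (l2_normD_le lf lg). Qed.

Lemma l2normD f g : l2 f -> l2 g -> l2norm (f + g) <= l2norm f + l2norm g.
Proof. by move=> lf lg; case: (l2_normD_le lf lg). Qed.

Lemma oppfZ f : - f = (-1) \*o f.
Proof. by apply/funext => v /=; rewrite mulN1r. Qed.

Lemma l2N f : l2 f -> l2 (- f).
Proof. by rewrite oppfZ; exact: l2Z. Qed.

Lemma l2normN f : l2 f -> l2norm (- f) = l2norm f.
Proof.
by move=> lf; rewrite oppfZ l2normZ // normc_opp Normc.normc1 mul1r.
Qed.

Lemma l2B f g : l2 f -> l2 g -> l2 (f - g).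
Proof. by move=> lf lg; apply: l2D => //; exact: l2N. Qed.

Lemma l2normB f g : l2 f -> l2 g -> l2norm (f - g) <= l2norm f + l2norm g.
Proof.
by move=> lf lg; rewrite -(l2normN lg); apply/l2normD => //; exact: l2N.
Qed.

Lemma cauchy_bound_cvg (x u : nat -> R) : u @ \oo --> (0 : R) ->
  (forall n m, (n <= m)%N -> `|x m - x n| <= u n) -> cvgn x.
Proof.
move=> u0 xu; apply: cauchy_cvg; apply: cauchy_exP => e e0.
have [N _ HN] : \forall n \near \oo, `|u n| < e.
  move/cvgrPdist_lt: u0 => /(_ e e0).
  by apply: filterS => n; rewrite sub0r normrN.
exists (x N), N => // n /= Nn; rewrite /ball /= distrC.
apply: le_lt_trans (xu _ _ Nn) _.
by apply: le_lt_trans (ler_norm _) _; exact: HN (leqnn N).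
Qed.

(** Pointwise limits exist because the norm dominates every coordinate. The bound [u n] passes to
    the limit on each finite set of coordinates, and from there to the whole sum. *)
Lemma l2_complete (g : nat -> V -> R[i]) (u : nat -> R) :
  u @ \oo --> (0 : R) -> (forall n, 0 <= u n) -> (forall n, l2 (g n)) ->
  (forall n m, (n <= m)%N -> l2norm (g m - g n) <= u n) ->
  exists2 G, l2 G & forall n, l2norm (G - g n) <= u n.
Proof.
move=> u0 up lg gu.
have gv n m v : (n <= m)%N -> normc (g m v - g n v) <= u n.
  move=> nm; apply: le_trans (gu _ _ nm).
  exact: (normc_le_l2norm v (l2B (lg m) (lg n))).
have cRe v : cvgn (fun n => complex.Re (g n v)).
  apply: (cauchy_bound_cvg u0) => n m nm; apply: le_trans (gv _ _ v nm).
  by rewrite -ReB; exact: Re_le_normc.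
have cIm v : cvgn (fun n => complex.Im (g n v)).
  apply: (cauchy_bound_cvg u0) => n m nm; apply: le_trans (gv _ _ v nm).
  by rewrite -ImB; exact: Im_le_normc.
pose G v : R[i] := limn (fun n => complex.Re (g n v)) +i*
                   limn (fun n => complex.Im (g n v)).
have cG n v : normc (g m v - g n v) ^+ 2 @[m --> \oo] -->
              normc (G v - g n v) ^+ 2.
  have E z w : normc (z - w) ^+ 2 =
      (complex.Re z - complex.Re w) ^+ 2 + (complex.Im z - complex.Im w) ^+ 2.
    by rewrite sqr_normcE ReB ImB.
  rewrite E; under eq_fun do rewrite E.
  apply: cvgD; rewrite expr2; under eq_fun do rewrite expr2.
    by apply: cvgM; (apply: cvgB; [exact: cRe|exact: cvg_cst]).
  by apply: cvgM; (apply: cvgB; [exact: cIm|exact: cvg_cst]).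
have key n : l2 (G - g n) /\ l2norm (G - g n) <= u n.
  apply: sqnorm_le => //; apply: sqnorm_le_finsum => s us.
  have cs : (\sum_(v <- s) normc (g m v - g n v) ^+ 2) @[m --> \oo] -->
            \sum_(v <- s) normc (G v - g n v) ^+ 2.
    apply: cvg_big => [|v _]; last exact: cG.
    exact: add_continuous.
  rewrite -(cvg_lim _ cs) //; apply: limr_le; first exact: cvgP cs.
  exists n => // m /= nm.
  apply: le_trans (finsum_le_l2norm (l2B (lg m) (lg n)) us) _.
  by rewrite ler_sqr ?nnegrE ?l2norm_ge0 ?gu.
exists G => [|n]; last by case: (key n).
by rewrite -(subrK (g 0%N) G); apply: l2D => //; case: (key 0%N).
Qed.

End L2.

(** * Resolvents *)

Section Resolvent.
Variables (R : realType) (V : choiceType).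
Implicit Types (f g : V -> R[i]) (A C : (V -> R[i]) -> V -> R[i]).
Local Notation normc := (@Normc.normc R).

Lemma opD A f g : bounded_operator A -> l2 f -> l2 g -> A (f + g) = A f + A g.
Proof.
case=> _ lA _ lf lg; have := lA 1 f g lf lg.
have e h : (1 : R[i]) \*o h = h by apply/funext => v; rewrite /= mul1r.
by rewrite !e.
Qed.

Lemma op0 A : bounded_operator A -> A 0 = 0.
Proof.
move=> bA; have := opD bA (@l2_0 R V) (@l2_0 R V).
by rewrite addr0 => /(congr1 (fun h => h - A 0)); rewrite subrr addrK.
Qed.

Lemma opZ A (z : R[i]) f : bounded_operator A -> l2 f ->
  A (z \*o f) = z \*o A f.
Proof.
move=> bA lf; have [_ lA _] := bA; have := lA z f 0 lf (@l2_0 R V).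
by rewrite (op0 bA) !addr0.
Qed.

Lemma opN A f : bounded_operator A -> l2 f -> A (- f) = - A f.
Proof. by move=> bA lf; rewrite !oppfZ opZ. Qed.

Lemma opB A f g : bounded_operator A -> l2 f -> l2 g -> A (f - g) = A f - A g.
Proof. by move=> bA lf lg; rewrite (opD bA lf (l2N lg)) (opN bA lg). Qed.

(** The lower bound makes [A - z] injective, which forces the inverse to be linear, and it bounds
    the inverse by 1/d. *)
Lemma resolvent_of_bij A z d : bounded_operator A -> 0 < d ->
  (forall f, l2 f -> d * l2norm f <= l2norm (A f - z \*o f)) ->
  (forall f, l2 f -> exists2 g, l2 g & A g - z \*o g = f) ->
  resolvent_set A z.
Proof.
move=> bA d0 lb sur; have [lA linA _] := bA.
(* The default 0 is taken only where no preimage in l2 exists, which surjectivity excludes for [f]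
   in l2. *)
pose B f := xget 0 [set g | l2 g /\ A g - z \*o g = f].
have BP f : l2 f -> l2 (B f) /\ A (B f) - z \*o B f = f.
  move=> lf; have [g lg gf] := sur f lf; rewrite /B.
  by case: xgetP => [h -> []//|/(_ g)[]].
have shiftB f g : l2 f -> l2 g ->
    A (f - g) - z \*o (f - g) = (A f - z \*o f) - (A g - z \*o g).
  move=> lf lg; rewrite opB //; apply/funext => v.
  by rewrite !fctE /=; ring.
have inj f g : l2 f -> l2 g -> A f - z \*o f = A g - z \*o g -> f = g.
  move=> lf lg fg; apply/eqP; rewrite -subr_eq0; apply/eqP.
  apply: l2norm_le0; first exact: l2B.
  have := lb _ (l2B lf lg); rewrite shiftB // fg subrr l2norm0.
  by rewrite pmulr_rle0.
exists B; last first.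
  move=> f lf; split; first by case: (BP f lf).
  have lh : l2 (A f - z \*o f) by apply: l2B; [exact: lA|exact: l2Z].
  by apply: inj => //; case: (BP _ lh).
split.
- by move=> f lf; case: (BP f lf).
- move=> a f g lf lg; have [lBf Bf] := BP f lf; have [lBg Bg] := BP g lg.
  have lh : l2 (a \*o f + g) by apply: l2D => //; exact: l2Z.
  have [lBh Bh] := BP _ lh; apply: inj => //.
    by apply: l2D => //; exact: l2Z.
  rewrite Bh linA // -{1}Bf -{1}Bg; apply/funext => v.
  by rewrite !fctE /=; ring.
- exists d^-1 => f lf; have [lBf Bf] := BP f lf.
  by rewrite -(ler_pM2l d0) mulrA divff ?gt_eqF // mul1r -{2}Bf lb.
Qed.

(** The solution is the Neumann series, the sum of the iterates C^n f; its partial sums satisfy C (S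
    n) = S (n + 1) - f. *)
Lemma neumann_surj C c : bounded_operator C -> 0 <= c -> c < 1 ->
  (forall f, l2 f -> l2norm (C f) <= c * l2norm f) ->
  forall f, l2 f -> exists2 g, l2 g & g - C g = f.
Proof.
move=> bC c0 c1 cC f lf; have [lC _ _] := bC.
pose t n := iter n C f.
have lt n : l2 (t n) by elim: n => //= n IH; exact: lC.
have tn n : l2norm (t n) <= c ^+ n * l2norm f.
  elim: n => [|n IH]; first by rewrite expr0 mul1r.
  by rewrite exprS -mulrA; apply: le_trans (cC _ (lt n)) _; rewrite ler_wpM2l.
pose S n := \sum_(k < n) t k.
have SS n : S n.+1 = S n + t n by rewrite /S big_ord_recr.
have lS n : l2 (S n).
  elim: n => [|n IH]; first by rewrite /S big_ord0; exact: l2_0.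
  by rewrite SS; exact: l2D.
have CS n : C (S n) = S n.+1 - f.
  elim: n => [|n IH].
    by rewrite SS /S big_ord0 (op0 bC) /t /= add0r subrr.
  rewrite SS (opD bC) // IH [in RHS]SS.
  by rewrite /t /= -/(t n) addrAC.
(* [u n] will be the geometric tail c^n |f| / (1 - c), which dominates the norms of all terms from
   index [n] on. *)
pose K := l2norm f / (1 - c).
have p : 0 < 1 - c by rewrite subr_gt0.
have K0 : 0 <= K by rewrite divr_ge0 ?l2norm_ge0 // ltW.
pose u n := K * c ^+ n.
have un n : 0 <= u n by rewrite mulr_ge0 // exprn_ge0.
have u0 : u @ \oo --> (0 : R).
  rewrite -[0](mulr0 K); apply: cvgM; first exact: cvg_cst.
  by apply: cvg_expr; rewrite ger0_norm.
have Su n m : (n <= m)%N -> l2norm (S m - S n) <= u n.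
  move=> /subnKC <-; move: (m - n)%N => {m} m.
  (* Bounding by the finite geometric sum, rather than by the whole tail, makes the induction on [m]
     close. *)
  suff: l2norm (S (n + m)%N - S n) <= u n - u (n + m)%N.
    by move=> /le_trans; apply; rewrite gerBl.
  elim: m => [|m IH]; first by rewrite addn0 !subrr l2norm0.
  have -> : S (n + m.+1)%N - S n = (S (n + m)%N - S n) + t (n + m)%N.
    by rewrite addnS SS addrAC.
  apply: le_trans (l2normD (l2B (lS _) (lS _)) (lt _)) _.
  apply: le_trans (lerD IH (tn _)) _.
  rewrite addnS -subr_ge0 /u exprS /K le_eqVlt; apply/orP; left; apply/eqP.
  by field; rewrite gt_eqF.
have [g lg gu] := l2_complete u0 un lS Su.
exists g => //; apply/eqP; rewrite -subr_eq0; apply/eqP.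
have lr : l2 (g - C g - f) by apply: l2B => //; apply: l2B => //; exact: lC.
apply: l2norm_le0 => //.
(* The residual does not depend on [n]; expressed through the error [g - S n], it is bounded by a
   null sequence. *)
have bnd n : l2norm (g - C g - f) <= u n + c * u n + c ^+ n * l2norm f.
  have -> : g - C g - f = (g - S n) - C (g - S n) - t n.
    rewrite (opB bC) // CS SS; apply/funext => v; rewrite !fctE /=; ring.
  have l1 : l2 (g - S n) by exact: l2B.
  have l3 : l2 (C (g - S n)) by exact: lC.
  apply: le_trans (l2normB (l2B l1 l3) (lt n)) _; apply: lerD => //.
  apply: le_trans (l2normB l1 l3) _; apply: lerD => //.
  by apply: le_trans (cC _ l1) _; rewrite ler_wpM2l.
have lim0 : (u n + c * u n + c ^+ n * l2norm f) @[n --> \oo] --> (0 : R).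
  rewrite [X in _ --> X](_ : 0 = 0 + c * 0 + 0 * l2norm f); last by ring.
  apply: cvgD; first apply: cvgD => //.
    by apply: cvgM => //; exact: cvg_cst.
  by apply: cvgM; [apply: cvg_expr; rewrite ger0_norm|exact: cvg_cst].
rewrite -(cvg_lim _ lim0) //; apply: limr_ge; first by apply/cvg_ex; exists 0.
by exists 0%N.
Qed.

(** [A - w] is -w (1 - A/w), where A/w has norm at most M/|w| < 1, so the Neumann series applies
    with right-hand side -f/w. *)
Lemma surj_large A M w : bounded_operator A -> 0 <= M -> M < normc w ->
  (forall f, l2 f -> l2norm (A f) <= M * l2norm f) ->
  forall f, l2 f -> exists2 g, l2 g & A g - w \*o g = f.
Proof.
move=> bA M0 Mw AM f lf; have [lA linA _] := bA.
have wp : 0 < normc w by exact: le_lt_trans Mw.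
have wn0 : w != 0.
  by apply: contraTneq wp => ->; rewrite Normc.normc0 ltxx.
have normV : normc w^-1 = (normc w)^-1 by exact: Normc.normcV.
have nC g : l2 g -> l2norm (w^-1 \*o A g) <= M / normc w * l2norm g.
  move=> lg; rewrite l2normZ ?normV; last exact: lA.
  by rewrite mulrC -mulrA [_^-1 * _]mulrC mulrA ler_wpM2r ?AM // invr_ge0 ltW.
have bC : bounded_operator (fun g => w^-1 \*o A g).
  split.
  - by move=> g lg; apply/l2Z/lA.
  - move=> a g h lg lh; rewrite linA //; apply/funext => v.
    by rewrite !fctE /=; ring.
  - by exists (M / normc w).
have c0 : 0 <= M / normc w by rewrite divr_ge0 // ltW.
have c1 : M / normc w < 1 by rewrite ltr_pdivrMr // mul1r.
have [g lg gf] := neumann_surj bC c0 c1 nC (l2Z w^-1 (l2N lf)).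
exists g => //; apply/funext => v.
move: gf => /(congr1 (fun h => w * h v)); rewrite !fctE /= => e.
have {e} : w * g v - A g v = - f v.
  by rewrite -[LHS]/(w * g v - A g v) -(mulVKf wn0 (- f v)) -e; field.
by move=> e; apply: oppr_inj; rewrite -e opprB.
Qed.

(** With [B] the inverse of [A - w], of norm at most 1/d, [A - z] factors as (1 - (z - w) B)(A - w),
    and the first factor is onto by the Neumann series. *)
Lemma surj_ball A w z d : bounded_operator A -> 0 < d ->
  (forall f, l2 f -> d * l2norm f <= l2norm (A f - w \*o f)) ->
  (forall f, l2 f -> exists2 g, l2 g & A g - w \*o g = f) ->
  normc (z - w) < d ->
  forall f, l2 f -> exists2 g, l2 g & A g - z \*o g = f.
Proof.
move=> bA d0 lb sur zw f lf.
have [B bB BP] := resolvent_of_bij bA d0 lb sur; have [lB linB _] := bB.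
have nB g : l2 g -> l2norm (B g) <= d^-1 * l2norm g.
  move=> lg; rewrite -(ler_pM2l d0) mulrA divff ?gt_eqF // mul1r.
  by have [e _] := BP g lg; have := lb _ (lB _ lg); rewrite e.
have nC g : l2 g -> l2norm ((z - w) \*o B g) <= normc (z - w) / d * l2norm g.
  move=> lg; rewrite l2normZ; last exact: lB.
  by rewrite -mulrA ler_wpM2l ?normc_ge0 ?nB.
have bC : bounded_operator (fun g => (z - w) \*o B g).
  split.
  - by move=> g lg; apply/l2Z/lB.
  - move=> a g h lg lh; rewrite linB //; apply/funext => v.
    by rewrite !fctE /=; ring.
  - by exists (normc (z - w) / d).
have c0 : 0 <= normc (z - w) / d by rewrite divr_ge0 ?normc_ge0 // ltW.
have c1 : normc (z - w) / d < 1 by rewrite ltr_pdivrMr // mul1r.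
have [g lg gf] := neumann_surj bC c0 c1 nC lf.
exists (B g); first exact: lB.
have [e _] := BP g lg; rewrite -gf; apply/funext => v.
by move/(congr1 (@^~ v)): e; rewrite !fctE /= => <-; ring.
Qed.

(* The discs of centre [iY] and radius [Y] exhaust the upper half-plane as
   [Y] grows, so two Neumann series reach every nonreal [z]. *)
Lemma resolvent_real_bound A M z : bounded_operator A -> 0 <= M ->
  (forall f, l2 f -> l2norm (A f) <= M * l2norm f) ->
  (forall w f, l2 f -> `|complex.Im w| * l2norm f <= l2norm (A f - w \*o f)) ->
  complex.Im z != 0 \/ M < normc z -> resolvent_set A z.
Proof.
move=> bA M0 AM Alb; have [lA _ _] := bA => -[z0|Mz]; last first.
  apply: (@resolvent_of_bij _ _ (normc z - M)) => //.
  - by rewrite subr_gt0.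
  - move=> f lf; rewrite mulrBl lerBlDr.
    have lAz : l2 (A f - z \*o f) by apply: l2B; [exact: lA|exact: l2Z].
    have := l2normB (lA _ lf) lAz; rewrite subKr l2normZ // => /le_trans; apply.
    by rewrite addrC lerD2l AM.
  - exact: surj_large Mz AM.
set y := complex.Im z in z0; set x := complex.Re z.
have y0 : 0 < `|y| by rewrite normr_gt0.
apply: (@resolvent_of_bij _ _ `|y|) => //; first exact: Alb.
(* The centre [w] lies on the imaginary axis, on the same side as [z]. The condition |z - w| < Y
   amounts to x^2 + y^2 < 2 Y |y|, which the last summand ensures; M + 1 puts [w] beyond the norm
   bound. *)
pose Y := M + 1 + (x ^+ 2 + y ^+ 2) / `|y|.
have q0 : 0 <= (x ^+ 2 + y ^+ 2) / `|y|.
  by rewrite divr_ge0 ?addr_ge0 ?sqr_ge0.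
have Y0 : 0 < Y by rewrite /Y; lra.
pose w : R[i] := 0 +i* (Num.sg y * Y).
have nw : `|complex.Im w| = Y.
  by rewrite /= normrM normr_sg z0 mul1r gtr0_norm.
apply: (@surj_ball _ w _ Y) => //.
- by move=> f lf; rewrite -{1}nw; exact: Alb.
- apply: (surj_large bA M0 _ AM).
  have -> : normc w = Y.
    by rewrite -nw /w /Normc.normc /= expr0n add0r sqrtr_sqr.
  by rewrite /Y; lra.
- rewrite -ltr_sqr ?nnegrE ?normc_ge0 ?(ltW Y0) // sqr_normcE.
  rewrite ReB ImB -/x -/y /= subr0.
  have : y = Num.sg y * `|y| by rewrite -numEsg.
  have : Num.sg y ^+ 2 = 1 by rewrite sqr_sg z0.
  move: (Num.sg y) => s s2 ys.
  have -> : (y - s * Y) ^+ 2 = (Y - `|y|) ^+ 2.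
    by rewrite {1}ys -mulrBr exprMn s2 mul1r -sqrrN opprB.
  have e : Y * `|y| = (M + 1) * `|y| + (x ^+ 2 + y ^+ 2).
    by rewrite /Y; field; rewrite gt_eqF.
  have : y ^+ 2 = `|y| ^+ 2 by rewrite real_normK ?num_real.
  have := mulr_ge0 M0 (ltW y0).
  move: e y0 (sqr_ge0 x) (sqr_ge0 y); clear; move: (Y) `|y| => {}Y b.
  nra.
Qed.

End Resolvent.

(** * Adjacency operators *)

(** By induction: if X^2 <= P Q for the tail, the new cross term 2 a X is at most b Q + P a^2/b by
    the inequality between arithmetic and geometric means. *)
Lemma weighted_CS (R : realFieldType) (T : Type) (r : seq T) (p x : T -> R) :
  (forall i, 0 < p i) -> (forall i, 0 <= x i) ->
  (\sum_(i <- r) x i) ^+ 2 <=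
  (\sum_(i <- r) p i) * (\sum_(i <- r) x i ^+ 2 / p i).
Proof.
move=> p0 x0; elim: r => [|i r IH]; first by rewrite !big_nil expr0n mulr0.
rewrite !big_cons; move: IH (x0 i) (p0 i).
have : 0 <= \sum_(j <- r) x j by exact: sumr_ge0.
have : 0 <= \sum_(j <- r) p j by apply: sumr_ge0 => j _; exact: ltW.
have : 0 <= \sum_(j <- r) x j ^+ 2 / p j.
  by apply: sumr_ge0 => j _; rewrite divr_ge0 ?sqr_ge0 // ltW.
move: (\sum_(j <- r) x j) (\sum_(j <- r) p j) (\sum_(j <- r) _ / _) (x i) (p i).
move=> X P Q a b Q0 P0 X0 XPQ a0 b0.
have c0 : 0 <= b * Q + P * (a ^+ 2 / b).
  by rewrite addr_ge0 // mulr_ge0 ?divr_ge0 ?sqr_ge0 // ltW.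
suff : 2 * (a * X) <= b * Q + P * (a ^+ 2 / b).
  have -> : (b + P) * (a ^+ 2 / b + Q) =
      a ^+ 2 + (b * Q + P * (a ^+ 2 / b)) + P * Q by field; rewrite gt_eqF.
  by move=> h; rewrite sqrrD -mulr_natl; apply: lerD => //; rewrite lerD2l.
rewrite -ler_sqr ?nnegrE // ?mulr_ge0 //.
apply: (@le_trans _ _ (4 * a ^+ 2 * (P * Q))).
  have -> : (2 * (a * X)) ^+ 2 = 4 * a ^+ 2 * X ^+ 2 by ring.
  by rewrite ler_wpM2l // mulr_ge0 ?sqr_ge0.
rewrite -subr_ge0.
have -> : (b * Q + P * (a ^+ 2 / b)) ^+ 2 - 4 * a ^+ 2 * (P * Q) =
    (b * Q - P * (a ^+ 2 / b)) ^+ 2 by field; rewrite gt_eqF.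
exact: sqr_ge0.
Qed.

Section Adjacency.
Variables (R : realType) (G : graph) (s : vertex G -> seq (dart G)).
Hypotheses (us : forall v, uniq (s v))
  (sP : forall v e, term e = v <-> e \in s v).
Implicit Types (f g : vertex G -> R[i]).
Local Notation normc := (@Normc.normc R).
Local Notation A := (@laplace R G (fun=> 1)).

Lemma term_flip (e : dart G) : term (flip e) = init e.
Proof. by rewrite -init_flip flipK. Qed.

Lemma adjE f v : A f v = \sum_(e <- s v) f (init e).
Proof.
by rewrite (laplace_seq _ _ (us v) (sP v)); under eq_bigr do rewrite mul1r.
Qed.

(** Each dart ends at exactly one vertex, so the lists [s v] partition the darts. *)
Lemma esum_darts (F : dart G -> \bar R) : (forall e, 0 <= F e)%E ->
  (\esum_(v in [set: vertex G]) \sum_(e <- s v) F e =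
   \esum_(e in [set: dart G]) F e)%E.
Proof.
move=> F0; pose J v := [set` s v].
have -> : (\esum_(v in [set: vertex G]) \sum_(e <- s v) F e =
    \esum_(v in [set: vertex G]) \esum_(e in J v) F e)%E.
  apply: eq_esum => v _; rewrite esum_fset //; last exact: finite_seq.
  by rewrite fsbig_seq.
rewrite (@esum_esum _ _ _ _ J (fun _ e => F e)) //.
rewrite (reindex_esum [set: dart G] _ (fun e => (term e, e))) //.
split.
- by move=> e _; split => //=; exact/sP.
- by move=> e1 e2 _ _ [].
- by move=> [v e] /= [_ /sP ev]; exists e => //; rewrite ev.
Qed.

Lemma esum_flip (F : dart G -> \bar R) :
  (\esum_(e in [set: dart G]) F (flip e) = \esum_(e in [set: dart G]) F e)%E.
Proof.
rewrite [RHS](reindex_esum [set: dart G] _ (@flip G)) //.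
split=> // [e1 e2 _ _ /(congr1 (@flip G))|e _]; first by rewrite !flipK.
by exists (flip e); rewrite ?flipK.
Qed.

Variables (h : vertex G -> R) (M : R).
Hypotheses (h0 : forall v, 0 < h v) (M0 : 0 <= M)
  (hM : forall v, \sum_(e <- s v) h (init e) <= M * h v).

(** Schur test: Cauchy-Schwarz with weights [h (init e)] and a first use of [hM] give a sum over the
    darts. Flipping every dart regroups that sum at the vertex carrying [x], where [hM] is used a
    second time. *)
Lemma schur_sqnorm (x : vertex G -> R) : (forall v, 0 <= x v) ->
  (\esum_(v in [set: vertex G]) ((\sum_(e <- s v) x (init e)) ^+ 2)%:E <=
   (M ^+ 2)%:E * \esum_(v in [set: vertex G]) (x v ^+ 2)%:E)%E.
Proof.
move=> x0; pose F (e : dart G) := M * h (term e) * (x (init e) ^+ 2 / h (init e)).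
have F0 e : 0 <= F e.
  apply: mulr_ge0; first by apply: mulr_ge0 => //; exact: ltW.
  by apply: divr_ge0; [exact: sqr_ge0|exact: ltW].
apply: (@le_trans _ _ (\esum_(v in [set: vertex G]) \sum_(e <- s v) (F e)%:E)%E).
  apply: le_esum => v _; rewrite sumEFin lee_fin.
  apply: le_trans (weighted_CS (s v) (fun e => h0 (init e)) (fun e => x0 (init e))) _.
  have -> : \sum_(e <- s v) F e =
      M * h v * \sum_(e <- s v) x (init e) ^+ 2 / h (init e).
    by rewrite mulr_sumr; apply: eq_big_seq => e /sP <-.
  apply: ler_wpM2r => //.
  by apply: sumr_ge0 => e _; rewrite divr_ge0 ?sqr_ge0 // ltW.
rewrite esum_darts => [|e]; last by rewrite lee_fin.
rewrite -esum_flip -esum_darts => [|e]; last by rewrite lee_fin.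
rewrite -esumZl ?sqr_ge0 // => [|v]; last exact: sqr_ge0.
apply: le_esum => v _; rewrite sumEFin lee_fin.
have -> : \sum_(e <- s v) F (flip e) =
    M * (x v ^+ 2 / h v) * \sum_(e <- s v) h (init e).
  rewrite mulr_sumr; apply: eq_big_seq => e /sP ev.
  by rewrite /F init_flip term_flip ev; exact: mulrAC.
have -> : M ^+ 2 * x v ^+ 2 = M * (x v ^+ 2 / h v) * (M * h v).
  by field; rewrite gt_eqF.
by rewrite ler_wpM2l // mulr_ge0 // divr_ge0 ?sqr_ge0 // ltW.
Qed.

Lemma adj_norm f : l2 f -> l2 (A f) /\ l2norm (A f) <= M * l2norm f.
Proof.
move=> lf; apply: sqnorm_le; first by rewrite mulr_ge0 ?l2norm_ge0.
rewrite exprMn EFinM -sqnormE //.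
apply: le_trans (schur_sqnorm (fun v => normc_ge0 (f v))).
apply: le_esum => v _; rewrite lee_fin ler_sqr ?nnegrE ?normc_ge0 //; last first.
  by apply: sumr_ge0 => e _; exact: normc_ge0.
rewrite adjE; elim: (s v) => [|e r IH]; first by rewrite !big_nil Normc.normc0.
by rewrite !big_cons; apply: le_trans (le_normcD _ _) _; rewrite lerD2l.
Qed.

Lemma adj_bounded : bounded_operator A.
Proof.
split; first by move=> f /adj_norm[].
  move=> a f g _ _; apply/funext => v; rewrite !fctE /= !adjE mulr_sumr.
  by rewrite -big_split.
by exists M => f /adj_norm[].
Qed.

(* Expanding |Af - zf|^2 produces the cross term [2 Im z Im (Af conj f)], a sum
   over the darts of a function that [flip] changes into its opposite. *)
Lemma adj_lower_bound z f : l2 f ->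
  `|complex.Im z| * l2norm f <= l2norm (A f - z \*o f).
Proof.
move=> lf; set y := complex.Im z.
have [lA nA] := adj_norm lf.
have lAz : l2 (A f - z \*o f) by apply: l2B => //; exact: l2Z.
pose phi (e : dart G) := 2 * y *
  (complex.Im (f (init e)) * complex.Re (f (term e)) -
   complex.Re (f (init e)) * complex.Im (f (term e))).
(* [p] is the positive part of [phi], and [p] composed with [flip] is its negative part. Both have
   the same sum [P] over the darts, which is how the total of [phi] vanishes without summing signed
   terms. *)
pose p e := Num.max (phi e) 0.
have p0 e : 0 <= p e by rewrite le_max lexx orbT.
have phiN e : phi (flip e) = - phi e.
  by rewrite /phi init_flip term_flip; ring.
have phiE e : phi e + p (flip e) = p e.
  rewrite /p phiN; have [pe|/ltW pe] := leP (phi e) 0.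
    by rewrite max_l ?oppr_ge0 // subrr.
  by rewrite max_r ?oppr_le0 // addr0.
pose P := (\esum_(e in [set: dart G]) (p e)%:E)%E.
have pbnd e : p e <= 4 * `|y| * (normc (f (init e)) * normc (f (term e))).
  rewrite /p ge_max; apply/andP; split; last first.
    by rewrite !mulr_ge0 ?normc_ge0.
  apply: le_trans (ler_norm _) _; rewrite /phi !normrM ger0_norm //.
  have -> : 4 * `|y| * (normc (f (init e)) * normc (f (term e))) =
    2 * `|y| * (normc (f (init e)) * normc (f (term e)) +
                normc (f (init e)) * normc (f (term e))) by ring.
  rewrite ler_wpM2l ?mulr_ge0 //; apply: le_trans (ler_normB _ _) _.
  by rewrite !normrM; apply: lerD; apply: ler_pM => //;
    rewrite ?Re_le_normc ?Im_le_normc.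
(* Finiteness allows [P] to be cancelled in the extended reals. It follows from a b <= a^2 + b^2,
   with a = [B v] the neighbour sum of |f| and b = |f v|, and from the Schur test. *)
have Pfin : P \is a fin_num.
  rewrite ge0_fin_numE; last by apply: esum_ge0 => e _; rewrite lee_fin.
  rewrite /P -esum_darts => [|e]; last by rewrite lee_fin.
  pose B v := \sum_(e <- s v) normc (f (init e)).
  have B0 v : 0 <= B v by apply: sumr_ge0 => e _; exact: normc_ge0.
  have y4 : 0 <= 4 * `|y| by rewrite mulr_ge0.
  apply: (@le_lt_trans _ _ (\esum_(v in [set: vertex G])
     ((4 * `|y|) * (B v ^+ 2))%:E + \esum_(v in [set: vertex G])
     ((4 * `|y|) * (normc (f v) ^+ 2))%:E)%E).
    rewrite -esumD; try by move=> v _; rewrite lee_fin mulr_ge0 ?sqr_ge0.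
    apply: le_esum => v _; rewrite sumEFin -EFinD lee_fin -mulrDr.
    apply: (@le_trans _ _ (4 * `|y| * (B v * normc (f v)))).
      rewrite mulr_suml mulr_sumr big_seq [leRHS]big_seq.
      by apply: ler_sum => e /sP <-; exact: pbnd.
    rewrite ler_wpM2l //; have := normc_ge0 (f v); have := B0 v.
    by move: (B v) (normc (f v)) => a b ? ?; nra.
  rewrite !esumZl //; try by move=> v; exact: sqr_ge0.
  apply: lte_add_pinfty.
    apply: (@le_lt_trans _ _ ((4 * `|y|)%:E *
      ((M ^+ 2)%:E * \esum_(v in [set: vertex G]) (normc (f v) ^+ 2)%:E))%E).
      apply: lee_pmul => //; last exact: schur_sqnorm (fun v => normc_ge0 (f v)).
      by apply: esum_ge0 => v _; rewrite lee_fin sqr_ge0.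
    by rewrite -/(sqnorm f) sqnormE // -!EFinM ltry.
  by rewrite -/(sqnorm f) sqnormE // -!EFinM ltry.
rewrite -ler_sqr ?nnegrE ?mulr_ge0 ?l2norm_ge0 //.
rewrite -lee_fin exprMn EFinM -!sqnormE //.
(* [P] is added to both sides, written on the left with the flipped darts and on the right with the
   darts themselves; what remains is then a pointwise inequality. *)
rewrite -(leeD2rE _ _ Pfin) -esumZl ?sqr_ge0 // => [|v]; last exact: sqr_ge0.
have PE : P = (\esum_(v in [set: vertex G]) \sum_(e <- s v) (p e)%:E)%E.
  by rewrite esum_darts // => e; rewrite lee_fin.
have PE' : P = (\esum_(v in [set: vertex G]) \sum_(e <- s v) (p (flip e))%:E)%E.
  by rewrite /P -esum_flip esum_darts // => e; rewrite lee_fin.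
rewrite {1}PE' PE {PE PE'}.
have sum0 (F : dart G -> R) v : (forall e, 0 <= F e) ->
    (0 <= \sum_(e <- s v) (F e)%:E)%E.
  by move=> F0; rewrite sumEFin lee_fin; apply: sumr_ge0.
rewrite -!esumD.
all: try by move=> v _; first [exact: sum0 | rewrite lee_fin sqr_ge0 |
  rewrite lee_fin mulr_ge0 ?sqr_ge0].
apply: le_esum => v _; rewrite !sumEFin -!EFinD lee_fin.
have -> : \sum_(e <- s v) p e =
    \sum_(e <- s v) phi e + \sum_(e <- s v) p (flip e).
  by rewrite -big_split /=; apply: eq_bigr => e _; rewrite phiE.
rewrite addrA lerD2r real_normK ?num_real //.
have -> : \sum_(e <- s v) phi e =
    2 * y * (complex.Im (A f v) * complex.Re (f v) -
             complex.Re (A f v) * complex.Im (f v)).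
  rewrite adjE !raddf_sum /= !mulr_suml -sumrB mulr_sumr.
  by apply: eq_big_seq => e /sP <-.
rewrite !sqr_normcE !fctE /= ReB ImB /y.
case: (A f v) (f v) z {y phi p phiN phiE P p0 pbnd Pfin lAz} => [a b] [c d] [x y] /=.
(* The two sides differ by |A f v - Re z * f v|^2. *)
have := sqr_ge0 (a - x * c); have := sqr_ge0 (b - x * d); nra.
Qed.

Lemma adj_resolvent z : complex.Im z != 0 \/ M < normc z -> resolvent_set A z.
Proof.
apply: resolvent_real_bound => //; first exact: adj_bounded.
  by move=> f /adj_norm[].
exact: adj_lower_bound.
Qed.

End Adjacency.

(** * Decaying solutions of recurrences *)

Section Decay.
Variable R : realType.
Implicit Types a : nat -> R.

Lemma cvg0_sqr_le a (v : nat -> R) : v @ \oo --> (0 : R) ->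
  (forall n, a n ^+ 2 <= v n) -> a @ \oo --> (0 : R).
Proof.
move=> v0 av; apply/cvgrPdist_lt => e e0.
move/cvgrPdist_lt: v0 => /(_ (e ^+ 2)); rewrite exprn_gt0 // => /(_ isT).
apply: filterS => n; rewrite !sub0r !normrN => vn.
rewrite -ltr_sqr ?nnegrE ?(ltW e0) // real_normK ?num_real //.
by apply: le_lt_trans (av n) (le_lt_trans (ler_norm _) vn).
Qed.

(** The label [l] makes the lists [s k] pairwise disjoint, so their contributions form a series of
    nonnegative terms with partial sums at most |f|^2. *)
Lemma l2_decay (V : choiceType) (f : V -> R[i]) (l : V -> nat)
    (s : nat -> seq V) : l2 f -> (forall k, uniq (s k)) ->
  (forall k v, v \in s k -> l v = k) ->
  (\sum_(v <- s k) Normc.normc (f v) ^+ 2) @[k --> \oo] --> (0 : R).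
Proof.
move=> lf us ls; pose a k := \sum_(v <- s k) Normc.normc (f v) ^+ 2.
have a0 k : 0 <= a k by apply: sumr_ge0 => v _; exact: sqr_ge0.
have sU n : uniq (flatten [seq s k | k <- iota 0 n]) /\
    forall v, v \in flatten [seq s k | k <- iota 0 n] -> (l v < n)%N.
  elim: n => [//|n [IH1 IH2]].
  rewrite -addn1 iotaD map_cat flatten_cat /= cats0 add0n; split.
    rewrite cat_uniq IH1 us andbT /=; apply/hasPn => v /ls lv.
    by apply/negP => /IH2; rewrite lv ltnn.
  by move=> v; rewrite mem_cat addn1 ltnS => /orP[/IH2/ltnW//|/ls ->].
apply: cvg_series_cvg_0; apply: nondecreasing_is_cvgn.
  by apply/nondecreasing_seqP => n; rewrite !seriesEnat /= big_nat_recr //= lerDl a0.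
exists (l2norm f ^+ 2) => _ [n _ <-]; have [u _] := sU n.
apply: le_trans (finsum_le_l2norm lf u).
by rewrite big_flatten big_map seriesEnat /= /index_iota subn0.
Qed.

Lemma l2_cvg0 (V : choiceType) (f : V -> R[i]) (l : V -> nat) (p : nat -> V) :
  l2 f -> cancel p l -> Normc.normc (f (p k)) @[k --> \oo] --> (0 : R).
Proof.
move=> lf pl.
have lp k v : v \in [:: p k] -> l v = k by rewrite inE => /eqP ->.
apply: (cvg0_sqr_le (@l2_decay _ f l (fun k => [:: p k]) lf (fun=> isT) lp)) => n.
by rewrite big_seq1.
Qed.

Lemma l2_Re_cvg0 (V : choiceType) (f : V -> R[i]) (l : V -> nat)
    (p : nat -> V) :
  l2 f -> cancel p l -> complex.Re (f (p k)) @[k --> \oo] --> (0 : R).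
Proof.
move=> lf pl; have h := l2_cvg0 lf pl.
apply: (@cvg0_sqr_le _ (fun k => Normc.normc (f (p k)) ^+ 2)) => [|n].
  by rewrite -[0](mulr0 (0 : R)); under eq_fun do rewrite expr2; exact: cvgM.
by rewrite sqr_normcE lerDl sqr_ge0.
Qed.

(* [a_{n+1}^2 - z a_{n+1} a_n + a_n^2] does not depend on [n], and it is a
   positive form when [|z| < 2], a square when [|z| = 2]. *)
Lemma recurrence_elliptic z a : z ^+ 2 <= 4 ->
  (forall n, a n.+2 = z * a n.+1 - a n) -> a @ \oo --> (0 : R) ->
  forall n, a n = 0.
Proof.
move=> z4 rec a0.
have aS0 : a n.+1 @[n --> \oo] --> (0 : R) by rewrite (cvg_shiftS a).
pose Q n := a n.+1 ^+ 2 - z * (a n.+1 * a n) + a n ^+ 2.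
have QE n : Q n = Q 0%N.
  by elim: n => [//|n <-]; rewrite /Q rec; ring.
have Q0 n : Q n = 0.
  rewrite QE; have : Q @ \oo --> (0 : R).
    rewrite [X in _ --> X](_ : 0 = 0 * 0 - z * (0 * 0) + 0 * 0); last by ring.
    apply: cvgD; first apply: cvgB.
    - by under eq_fun do rewrite expr2; exact: cvgM.
    - by apply: cvgM; [exact: cvg_cst|exact: cvgM].
    - by under eq_fun do rewrite expr2; exact: cvgM.
  have -> : Q = fun=> Q 0%N by apply/funext => k; exact: QE.
  by move=> /cvg_lim <- //; rewrite lim_cst.
(* Completing the square in Q = 0 gives a_{n+1} = (z/2) a_n and (1 - z^2/4) a_n^2 = 0, whence
   a_{n+1}^2 = a_n^2. A constant sequence tending to 0 vanishes; this treats |z| < 2 and |z| = 2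
   together. *)
have sqE n : a n ^+ 2 = a 0%N ^+ 2.
  elim: n => [//|n <-]; have := Q0 n; rewrite /Q => q.
  have e : (a n.+1 - z / 2 * a n) ^+ 2 + (1 - z ^+ 2 / 4) * a n ^+ 2 = 0.
    by rewrite -q; field.
  have p1 : 0 <= (1 - z ^+ 2 / 4) * a n ^+ 2.
    by rewrite mulr_ge0 ?sqr_ge0 // subr_ge0 ler_pdivrMr // mul1r.
  have p2 := sqr_ge0 (a n.+1 - z / 2 * a n).
  have e1 : (a n.+1 - z / 2 * a n) ^+ 2 = 0 by lra.
  have e2 : (1 - z ^+ 2 / 4) * a n ^+ 2 = 0 by lra.
  move/eqP: e1; rewrite sqrf_eq0 subr_eq0 => /eqP ->.
  by apply/eqP; rewrite -subr_eq0 -oppr_eq0 -e2; apply/eqP; field.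
move=> n; apply/eqP; rewrite -sqrf_eq0 sqE; apply/eqP.
have : a n ^+ 2 @[n --> \oo] --> (0 : R).
  by rewrite -[0](mulr0 (0 : R)); under eq_fun do rewrite expr2; exact: cvgM.
have -> : (fun n => a n ^+ 2) = fun=> a 0%N ^+ 2 by apply/funext => k; exact: sqE.
by move=> /cvg_lim <- //; rewrite lim_cst.
Qed.

(* [a_{n+1} - t a_n] is multiplied by [m], with [|m| > 1], at each step. *)
Lemma recurrence_hyperbolic z t m a : t + m = z -> t * m = 1 -> t ^+ 2 < 1 ->
  (forall n, a n.+2 = z * a n.+1 - a n) -> a @ \oo --> (0 : R) ->
  a 1%N = t * a 0%N.
Proof.
move=> tm tm1 t1 rec a0.
have aS0 : a n.+1 @[n --> \oo] --> (0 : R) by rewrite (cvg_shiftS a).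
pose b n := (a n.+1 - t * a n) ^+ 2.
have bS n : b n.+1 = m ^+ 2 * b n.
  rewrite /b rec -tm -exprMn mulrBr mulrA [m * t]mulrC tm1 mul1r.
  by congr (_ ^+ 2); ring.
have m1 : 1 <= m ^+ 2.
  have : t ^+ 2 * m ^+ 2 = 1 by rewrite -exprMn tm1 expr1n.
  by have := sqr_ge0 t; have := sqr_ge0 m; nra.
have bn n : b 0%N <= b n.
  elim: n => [//|n IH]; apply: le_trans IH _; rewrite bS.
  by rewrite ler_peMl // /b sqr_ge0.
have : b @ \oo --> (0 : R).
  rewrite [X in _ --> X](_ : 0 = (0 - t * 0) * (0 - t * 0)); last by ring.
  have h : (a n.+1 - t * a n) @[n --> \oo] --> 0 - t * 0.
    by apply: cvgB => //; apply: cvgM => //; exact: cvg_cst.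
  by rewrite /b; under eq_fun do rewrite expr2; exact: cvgM.
move=> b0; have : b 0%N <= 0.
  rewrite -(cvg_lim _ b0) //; apply: limr_ge; first by apply/cvg_ex; exists 0.
  by exists 0%N.
move=> b00; have /eqP : b 0%N = 0 by apply/le_anti; rewrite b00 /b sqr_ge0.
by rewrite sqrf_eq0 subr_eq0 => /eqP.
Qed.

(** These are the roots of X^2 - z X + 1; the sign of [z] decides which of them has modulus below
    1. *)
Lemma hyperbolic_roots (z : R) : 4 < z ^+ 2 ->
  exists t m, [/\ t + m = z, t * m = 1 & t ^+ 2 < 1].
Proof.
move=> z4; pose r := Num.sqrt (z ^+ 2 - 4).
have r2 : r ^+ 2 = z ^+ 2 - 4 by rewrite sqr_sqrtr // subr_ge0 ltW.
have r0 : 0 < r by rewrite sqrtr_gt0 subr_gt0.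
have [zp|zn] : 0 <= z \/ z < 0 by case: (lerP 0 z); [left|right].
  by exists ((z - r) / 2); exists ((z + r) / 2); split; [field|nra|nra].
by exists ((z + r) / 2); exists ((z - r) / 2); split; [field|nra|nra].
Qed.

End Decay.

(** * The spectrum of Gamma *)

Section SimpleGraphDarts.
Variables (V : choiceType) (adj : rel V).
Hypotheses (adj_sym : symmetric adj) (adj_irr : irreflexive adj).
Variable N : V -> seq V.
Hypotheses (uN : forall v, uniq (N v)) (NP : forall u v, adj u v = (u \in N v)).
Local Notation G := (simple_graph adj_sym adj_irr).

(** No pair is lost through [insub], since every member of [N v] is adjacent to [v]. *)
Definition simple_in (v : V) : seq (dart G) :=
  pmap insub [seq (u, v) | u <- N v].

Lemma simple_in_uniq v : uniq (simple_in v).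
Proof. by apply: pmap_sub_uniq; rewrite map_inj_uniq // => u1 u2 []. Qed.

Lemma simple_inP v (e : dart G) : term e = v <-> e \in simple_in v.
Proof.
rewrite /simple_in mem_pmap_sub; split=> [<-|/mapP[u _ eu]]; last by rewrite /= eu.
apply/mapP; exists (val e).1; last exact: surjective_pairing.
by rewrite -NP; exact: (valP (e : simple_dart adj)).
Qed.

Lemma sum_simple_in (S : nmodType) (F : V -> S) v :
  \sum_(e <- simple_in v) F (init e) = \sum_(u <- N v) F u.
Proof.
rewrite -[RHS](big_map (fun u => (u, v)) xpredT (fun p => F p.1)).
have -> : [seq (u, v) | u <- N v] = map val (simple_in v).
  rewrite /simple_in pmap_filter; last exact: insubK.
  apply/esym/all_filterP/allP => _ /mapP[u uv ->].
  by rewrite isSome_insub NP.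
by rewrite big_map.
Qed.

End SimpleGraphDarts.

Definition line_nbrs (n : nat) : seq nat :=
  if n is j.+1 then [:: j; j.+2] else [:: 1%N].

Lemma line_nbrs_uniq n : uniq (line_nbrs n).
Proof. by case: n => [//|j] /=; rewrite inE; lia. Qed.

Lemma line_nbrsP i n : line_adj i n = (i \in line_nbrs n).
Proof. by rewrite /line_adj; case: n => [|j]; rewrite !inE; lia. Qed.

Definition line_in : vertex GammaN -> seq (dart GammaN) :=
  simple_in line_adj_sym line_adj_irr line_nbrs.

Lemma line_in_uniq (n : vertex GammaN) : uniq (line_in n).
Proof. exact: (simple_in_uniq _ _ line_nbrs_uniq). Qed.

Lemma line_inP (n : vertex GammaN) (e : dart GammaN) :
  term e = n <-> e \in line_in n.
Proof. exact: (simple_inP line_nbrsP). Qed.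

Lemma sum_line_in (S : nmodType) (F : nat -> S) n :
  \sum_(e <- line_in n) F (init e) = \sum_(i <- line_nbrs n) F i.
Proof. exact: (sum_simple_in _ _ line_nbrsP). Qed.

(** * Green function of the half-line and its rank-one perturbation *)

Section GammaSpectrum.
Variable R : realType.
Local Notation normc := (@Normc.normc R).
Local Notation H := (@laplace R Gamma (fun=> 1)).
Local Notation J := (@laplace R GammaN (fun=> 1)).

Definition delta (V : choiceType) (o : V) : V -> R[i] := fun v => (v == o)%:R.

Lemma l2_delta (V : choiceType) (o : V) : l2 (delta o).
Proof.
apply: (@le_lt_trans _ _ 1%:E); last exact: ltry.
apply: sqnorm_le_finsum => s us.
have [os|os] := boolP (o \in s).
  rewrite (bigD1_seq o) //= /delta eqxx Normc.normc1 expr1n big1 ?addr0 //.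
  by move=> v vo /=; rewrite (negbTE vo) Normc.normc0 expr0n.
rewrite big_seq big1 // => v vs.
have /negbTE vo : v != o by apply: contraNneq os => <-.
by rewrite /delta vo Normc.normc0 expr0n.
Qed.

Lemma Re_mul_real (x : R) (z : R[i]) : complex.Re (x%:C * z) = x * complex.Re z.
Proof. by case: z => a b /=; rewrite mul0r subr0. Qed.

Lemma ReD (z w : R[i]) : complex.Re (z + w) = complex.Re z + complex.Re w.
Proof. by case: z w => [a b] [c d]. Qed.

Lemma laplace_line0 (f : nat -> R[i]) : J f 0%N = f 1%N.
Proof.
by rewrite (adjE line_in_uniq line_inP) (sum_line_in f) big_seq1.
Qed.

Lemma laplace_lineS (f : nat -> R[i]) n : J f n.+1 = f n + f n.+2.
Proof.
by rewrite (adjE line_in_uniq line_inP) (sum_line_in f) big_cons big_seq1.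
Qed.

Lemma laplace_Gamma_line (f : nat -> R[i]) :
  H f = J f + (4 * f 0%N) \*o delta 0%N.
Proof.
apply/funext => -[|n]; rewrite !fctE /= /delta.
  by rewrite laplace_Gamma0 laplace_line0 /= mulr1 addrC.
by rewrite laplace_GammaS laplace_lineS mulr0 addr0.
Qed.

Lemma line_weight n :
  \sum_(e <- line_in n) (fun=> 1 : R) (init e) <= 2 * (fun=> 1) n.
Proof.
rewrite (sum_line_in (fun=> 1)) mulr1; case: n => [|n].
  by rewrite big_seq1 ler1n.
by rewrite /= big_cons big_seq1.
Qed.

Lemma line_bounded : bounded_operator J.
Proof.
exact: (adj_bounded line_in_uniq line_inP (fun=> ltr01) (ler0n _ 2) line_weight).
Qed.

Lemma line_resolvent z : complex.Im z != 0 \/ 2 < normc z -> resolvent_set J z.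
Proof.
exact: (adj_resolvent line_in_uniq line_inP (fun=> ltr01) (ler0n _ 2) line_weight).
Qed.

(* If [1 + 4 u 0 = 0], then [u] is an eigenfunction of [H]; the quantity
   [u_{n+1}^2 - z u_{n+1} u_n + u_n^2] is constant, hence zero, and its value
   at [0] is [(17 - 4 z) / 16]. *)
Lemma line_green0 z u : l2 u -> J u - z \*o u = delta 0%N ->
  z != 17 / 4 -> 1 + 4 * u 0%N != 0.
Proof.
move=> lu Ju; apply: contra_neq => c0.
have e0 : u 1%N = z * u 0%N + 1.
  have := congr1 (@^~ 0%N) Ju; rewrite !fctE /= laplace_line0 /delta eqxx => e.
  by rewrite addrC (_ : 1 = u 1%N - z * u 0%N) ?subrK //; exact: esym e.
have rec n : u n.+2 = z * u n.+1 - u n.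
  have := congr1 (@^~ n.+1) Ju; rewrite !fctE /= laplace_lineS /delta /= => e.
  by apply/eqP; rewrite -subr_eq0; apply/eqP; rewrite -[RHS]e; ring.
pose Q n := u n.+1 ^+ 2 - z * (u n.+1 * u n) + u n ^+ 2.
have QE n : Q n = Q 0%N by elim: n => [//|n <-]; rewrite /Q rec; ring.
have Q0 : Q 0%N = 0.
  have d0 := @l2_cvg0 _ _ u id id lu (fun n : nat => erefl n).
  pose d n := normc (u n).
  have dS0 : d n.+1 @[n --> \oo] --> (0 : R).
    by rewrite (cvg_shiftS d).
  have qd n : normc (Q 0%N) <=
      d n.+1 * d n.+1 + normc z * (d n.+1 * d n) + d n * d n.
    rewrite -(QE n) /Q /d -!Normc.normcM -!expr2.
    apply: le_trans (le_normcD _ _) _; rewrite lerD2r.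
    apply: le_trans (le_normcD _ _) _.
    by rewrite normc_opp.
  have lim0 : (d n.+1 * d n.+1 + normc z * (d n.+1 * d n) + d n * d n)
      @[n --> \oo] --> (0 : R).
    rewrite [X in _ --> X](_ : 0 = 0 * 0 + normc z * (0 * 0) + 0 * 0); last by ring.
    apply: cvgD; first apply: cvgD; try exact: cvgM.
    by apply: cvgM; [exact: cvg_cst|exact: cvgM].
  apply: Normc.eq0_normc; apply/eqP; rewrite eq_le normc_ge0 andbT.
  rewrite -(cvg_lim _ lim0) //; apply: limr_ge; first by apply/cvg_ex; exists 0.
  by exists 0%N.
have u0 : u 0%N = - (1 / 4).
  have -> : u 0%N = (1 + 4 * u 0%N) / 4 - 1 / 4 by field.
  by rewrite c0 mul0r sub0r.
have q : Q 0%N = (17 - 4 * z) / 16 by rewrite /Q e0 u0; field.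
have : 17 - 4 * z = 16 * Q 0%N by rewrite q; field.
rewrite Q0 mulr0 => /eqP; rewrite subr_eq0 => /eqP e.
by rewrite e; field.
Qed.

(** Rank-one resolvent formula: with [B] the resolvent of the half-line and u = B delta, the inverse
    sends [f] to B f - (4 (B f)(0) / (1 + 4 u(0))) u. The denominator is nonzero because [z] is not
    17/4. *)
Lemma Gamma_resolvent z : complex.Im z != 0 \/ 2 < normc z -> z != 17 / 4 ->
  resolvent_set H z.
Proof.
move=> z2 z17; have [B bB BP] := line_resolvent z2; have [lB linB [b Bb]] := bB.
have ld := l2_delta 0%N; pose u := B (delta 0%N).
have lu : l2 u by exact: lB.
have [Ju _] := BP _ ld.
have c0 := line_green0 lu Ju z17; set c := 1 + 4 * u 0%N in c0.
pose k f := 4 * B f 0%N / c.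
have lk f : l2 f -> l2 (k f \*o u) by move=> _; exact: l2Z.
exists (fun f => B f - k f \*o u).
  split.
  - by move=> f lf; apply: l2B; [exact: lB|exact: lk].
  - move=> a f g lf lg; rewrite /k linB //; apply/funext => v.
    by rewrite !fctE /=; field.
  - exists (b + 4 / normc c * l2norm u * b) => f lf.
    apply: le_trans (l2normB (lB _ lf) (lk _ lf)) _.
    rewrite mulrDl; apply: lerD; first exact: Bb.
    rewrite (l2normZ _ lu).
    have nk : normc (k f) = 4 / normc c * normc (B f 0%N).
      rewrite /k !Normc.normcM Normc.normcV.
      have -> : normc 4 = 4 by rewrite -(rmorph_nat (real_complex R)) normc_real normr_nat.
      by rewrite mulrAC.
    have -> : 4 / normc c * l2norm u * b * l2norm f =
      4 / normc c * (b * l2norm f) * l2norm u by ring.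
    rewrite nk; apply: ler_wpM2r; first exact: l2norm_ge0.
    apply: ler_wpM2l; first by rewrite divr_ge0 ?normc_ge0.
    exact: le_trans (normc_le_l2norm _ (lB _ lf)) (Bb _ lf).
move=> f lf; have [JB BJ] := BP f lf; have [lJ linJ _] := line_bounded.
have luz : l2 (z \*o f) by exact: l2Z.
split.
  have Jg : J (B f - k f \*o u) = J (B f) - k f \*o J u.
    rewrite (opB line_bounded (lB _ lf) (lk _ lf)); congr (_ - _).
    exact: (opZ (k f) line_bounded lu).
  rewrite laplace_Gamma_line Jg.
  apply/funext => v; rewrite !fctE /=.
  have e1 := congr1 (@^~ v) JB; rewrite !fctE /= in e1.
  have e2 := congr1 (@^~ v) Ju; rewrite !fctE /= in e2.
  have -> : J (B f) v = f v + z * B f v by rewrite -e1 subrK.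
  have -> : J u v = delta 0%N v + z * u v by rewrite -e2 subrK.
  rewrite /k /c; rewrite /c in c0; field; exact: c0.
have e : H f - z \*o f = (4 * f 0%N) \*o delta 0%N + (J f - z \*o f).
  by rewrite laplace_Gamma_line addrAC addrC.
have lJz : l2 (J f - z \*o f) by apply: l2B => //; exact: lJ.
have E : B (H f - z \*o f) = (4 * f 0%N) \*o u + f by rewrite e linB // BJ.
rewrite /k E; apply/funext => v; rewrite !fctE /= /c.
rewrite /c in c0; field; exact: c0.
Qed.

Lemma Gamma_spectrum_real (x : R) : x ^+ 2 <= 4 \/ x = 17 / 4 ->
  spectrum H x%:C.
Proof.
move=> hx [B [lB _ _] BP]; have ld := l2_delta 0%N.
have [e _] := BP _ ld; have lg := lB _ ld; move: (B _) lg e => g lg e {BP lB}.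
(* Since [x] and the delta function are real, the real part of [g] satisfies the same equations. *)
pose a n := complex.Re (g n).
have a0 : a @ \oo --> (0 : R).
  exact: (@l2_Re_cvg0 _ _ g id id lg (fun n : nat => erefl n)).
have rec n : a n.+2 = x * a n.+1 - a n.
  have := congr1 (@^~ n.+1) e; rewrite !fctE /= laplace_GammaS /delta /=.
  move/(congr1 (@complex.Re R)); rewrite ReB ReD Re_mul_real -!/(a _) /= => h.
  by apply/eqP; rewrite -subr_eq0; apply/eqP; rewrite -[RHS]h; ring.
have init : 4 * a 0%N + a 1%N - x * a 0%N = 1.
  have := congr1 (@^~ 0%N) e; rewrite !fctE /= laplace_Gamma0 /delta /=.
  move/(congr1 (@complex.Re R)); rewrite ReB ReD Re_mul_real.
  have -> : (4 : R[i]) = (4 : R)%:C by rewrite rmorph_nat.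
  by rewrite Re_mul_real.
case: hx => hx.
  have z := recurrence_elliptic hx rec a0.
  by move: init; rewrite !z; lra.
(* 17/4 = 1/4 + 4, so the decaying solution has ratio 1/4; then 4 + 1/4 - 17/4 = 0 contradicts the
   equation at the loop vertex. *)
have a1 : a 1%N = 1 / 4 * a 0%N.
  by apply: (@recurrence_hyperbolic _ x (1 / 4) 4 a _ _ _ rec a0); lra.
by move: init; rewrite hx a1; lra.
Qed.

End GammaSpectrum.

(** * The spectrum of GammaTilde *)

Section AttachDarts.
Variables (G F : graph) (r : vertex F).
Variables (sG : vertex G -> seq (dart G)) (sF : vertex F -> seq (dart F)).
Hypotheses (uG : forall v, uniq (sG v))
  (PG : forall v e, term e = v <-> e \in sG v).
Hypotheses (uF : forall v, uniq (sF v))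
  (PF : forall v e, term e = v <-> e \in sF v).
Local Notation K := (attach G r).

Definition attach_in (v : vertex K) : seq (dart K) :=
  (if v.2 == r then [seq inl e | e <- sG v.1] else [::]) ++
  [seq inr (v.1, e) | e <- sF v.2].

Lemma attach_in_uniq v : uniq (attach_in v).
Proof.
have inlI : injective (inl : dart G -> dart K) by move=> e1 e2 [].
have inrI : injective (fun e => inr (v.1, e) : dart K) by move=> e1 e2 [].
rewrite cat_uniq (map_inj_uniq inrI) uF andbT; apply/andP; split.
  by case: ifP => // _; rewrite (map_inj_uniq inlI).
apply/hasPn => _ /mapP[e _ ->]; case: ifP => // _.
by apply/negP => /mapP[].
Qed.

Lemma attach_inP v (e : dart K) : term e = v <-> e \in attach_in v.
Proof.
case: v => x n; rewrite /attach_in mem_cat /=; case: e => [e|[y e]]; split.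
- by case=> ex nr; rewrite -nr eqxx; apply/orP; left; apply/map_f/PG.
- case/orP => [|/mapP[]//]; case: eqP => // -> /mapP[e' /PG ex [->]].
  by rewrite -ex.
- by case=> -> en; apply/orP; right; apply/map_f/PF.
- case/orP => [|/mapP[e' /PF en [-> ->]]]; last by rewrite -en.
  by case: ifP => // _ /mapP[].
Qed.

Lemma sum_attach_in (S : nmodType) (W : vertex K -> S) x n :
  \sum_(e <- attach_in (x, n)) W (init e) =
  (if n == r then \sum_(e <- sG x) W (init e, r) else 0) +
  \sum_(e <- sF n) W (x, init e).
Proof.
rewrite big_cat !big_map /=; congr (_ + _).
by case: ifP; rewrite ?big_nil // big_map.
Qed.

End AttachDarts.

(** * Neighbour sums in the tree and in the covering graph *)

Definition T4_nbrs (u : T4_vertex) : seq T4_vertex :=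
  [seq T4_nbr u a | a <- enum 'I_4].

Lemma T4_nbrs_uniq u : uniq (T4_nbrs u).
Proof. by rewrite map_inj_uniq ?enum_uniq //; case: (T4_regular u). Qed.

Lemma T4_nbrsP u v : T4_adj u v = (u \in T4_nbrs v).
Proof.
have [_ h] := T4_regular v; rewrite T4_adj_sym; apply/idP/mapP.
  by move=> /h[a ->]; exists a; rewrite ?mem_enum.
by move=> [a _ ->]; apply/h; exists a.
Qed.

Definition T4_in : vertex T4 -> seq (dart T4) :=
  simple_in T4_adj_sym T4_adj_irr T4_nbrs.

Definition GammaTilde_in : vertex GammaTilde -> seq (dart GammaTilde) :=
  @attach_in T4 GammaN 0%N T4_in line_in.

Lemma GammaTilde_in_uniq v : uniq (GammaTilde_in v).
Proof.
apply: attach_in_uniq; last exact: line_in_uniq.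
exact: (simple_in_uniq _ _ T4_nbrs_uniq).
Qed.

Lemma GammaTilde_inP v (e : dart GammaTilde) :
  term e = v <-> e \in GammaTilde_in v.
Proof.
apply: attach_inP; last exact: line_inP.
exact: (simple_inP T4_nbrsP).
Qed.

Lemma sum_T4_in (S : nmodType) (F : T4_vertex -> S) x :
  \sum_(e <- T4_in x) F (init e) = \sum_(a < 4) F (T4_nbr x a).
Proof.
transitivity (\sum_(u <- T4_nbrs x) F u).
  exact: (sum_simple_in _ _ T4_nbrsP).
by rewrite big_map big_enum.
Qed.

Lemma sum_GammaTilde_in0 (S : nmodType) (F : vertex GammaTilde -> S) x :
  \sum_(e <- GammaTilde_in (x, 0%N)) F (init e) =
  \sum_(a < 4) F (T4_nbr x a, 0%N) + F (x, 1%N).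
Proof.
rewrite sum_attach_in eqxx (sum_T4_in (fun y => F (y, 0%N))).
by rewrite (sum_line_in (fun n => F (x, n))) big_seq1.
Qed.

Lemma sum_GammaTilde_inS (S : nmodType) (F : vertex GammaTilde -> S) x n :
  \sum_(e <- GammaTilde_in (x, n.+1)) F (init e) = F (x, n) + F (x, n.+2).
Proof.
rewrite sum_attach_in /= add0r (sum_line_in (fun n => F (x, n))).
by rewrite big_cons big_seq1.
Qed.

(** * Children, parents and spheres of the rooted tree *)

Definition T4_root : T4_vertex := exist _ [::] isT.

Definition T4_depth (x : T4_vertex) : nat := size (val x).

(** The letters whose move lengthens the word; the head letter is left out because its move cancels
    it and leads to the parent. *)
Definition T4_letters (x : T4_vertex) : seq 'I_4 :=
  [seq a <- enum 'I_4 | ohead (val x) != Some a].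

Definition T4_children (x : T4_vertex) : seq T4_vertex :=
  [seq T4_nbr x a | a <- T4_letters x].

(** At the root this returns the root itself, a dummy value; sums over neighbours treat the root
    apart. *)
Definition T4_parent (x : T4_vertex) : T4_vertex :=
  insubd T4_root (behead (val x)).

Lemma val_T4_child x a : a \in T4_letters x -> val (T4_nbr x a) = a :: val x.
Proof.
rewrite mem_filter val_T4_nbr => /andP[+ _].
case: (val x) => [//|b w] /= ab; case: eqVneq => // e.
by rewrite e eqxx in ab.
Qed.

Lemma T4_parent_nbr x a : a \in T4_letters x -> T4_parent (T4_nbr x a) = x.
Proof.
move=> /val_T4_child e; apply: val_inj; rewrite /T4_parent e /=.
by rewrite insubdK //; exact: (valP x).
Qed.

Lemma T4_parent_child x y : y \in T4_children x -> T4_parent y = x.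
Proof. by case/mapP => a /T4_parent_nbr ax ->. Qed.

Lemma T4_depth_child x y : y \in T4_children x -> T4_depth y = (T4_depth x).+1.
Proof. by case/mapP => a /val_T4_child e ->; rewrite /T4_depth e. Qed.

Lemma size_T4_children x :
  size (T4_children x) = (if x == T4_root then 4 else 3)%N.
Proof.
rewrite size_map size_filter -val_eqE /=; case: (val x) => [|b w] /=.
  by rewrite (eq_count (a2 := predT)) // count_predT size_enum_ord.
rewrite (eq_count (a2 := predC1 b)) => [|a]; last by rewrite /= eq_sym.
have := count_predC (pred1 b) (enum 'I_4).
by rewrite count_uniq_mem ?enum_uniq // mem_enum size_enum_ord add1n => -[].
Qed.

Lemma T4_depth_parent x : x != T4_root ->
  (T4_depth (T4_parent x)).+1 = T4_depth x.
Proof.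
rewrite -val_eqE /T4_depth /T4_parent; case: x => [[|b w] rw] //= _.
by rewrite insubdK //; exact: (path_sorted rw).
Qed.

Lemma sum_T4_nbrs (S : nmodType) (F : T4_vertex -> S) x :
  \sum_(a < 4) F (T4_nbr x a) =
  \sum_(y <- T4_children x) F y + (if x == T4_root then 0 else F (T4_parent x)).
Proof.
rewrite big_map big_filter big_enum_cond /= (bigID (fun a => ohead (val x) != Some a)) /=.
congr (_ + _); rewrite -val_eqE /=.
case e: (val x) => [|b w] /=; first by rewrite big_pred0.
rewrite (big_pred1 b) => [|a]; last by rewrite negbK /= eq_sym.
congr F; apply: val_inj; rewrite val_T4_nbr /T4_parent e /= eqxx insubdK //.
by have := valP x; rewrite e => /path_sorted.
Qed.

Fixpoint T4_level (k : nat) : seq T4_vertex :=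
  if k is j.+1 then [seq y | x <- T4_level j, y <- T4_children x]
  else [:: T4_root].

Lemma T4_level_depth k x : x \in T4_level k -> T4_depth x = k.
Proof.
elim: k x => [|k IH] x /=; first by rewrite inE => /eqP ->.
by case/allpairsPdep => y [z [yk zy ->]]; rewrite (T4_depth_child zy) (IH _ yk).
Qed.

Lemma T4_level_root k x : x \in T4_level k.+1 -> (x == T4_root) = false.
Proof. by move=> /T4_level_depth h; apply: contra_eqF h => /eqP ->. Qed.

Lemma T4_children_uniq x : uniq (T4_children x).
Proof.
rewrite map_inj_uniq; first by rewrite filter_uniq ?enum_uniq.
by case: (T4_regular x).
Qed.

(** A child determines its parent, so distinct vertices of a level have disjoint lists of
    children. *)
Lemma T4_level_uniq k : uniq (T4_level k).
Proof.
elim: k => [//|k] /=; elim: (T4_level k) => [//|x s IH] /= /andP[xs us].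
rewrite cat_uniq map_id T4_children_uniq IH // andbT; apply/hasPn => y.
case/allpairsPdep => x' [y' [x's yx' ->]] /=; apply: contra xs.
by move=> /T4_parent_child <-; rewrite (T4_parent_child yx').
Qed.

Lemma sum_T4_levelS (S : nmodType) (F : T4_vertex -> S) k :
  \sum_(y <- T4_level k.+1) F y =
  \sum_(x <- T4_level k) \sum_(y <- T4_children x) F y.
Proof. by rewrite big_allpairs_dep. Qed.

Lemma size_T4_level k : size (T4_level k.+1) = (4 * 3 ^ k)%N.
Proof.
have h j : size (T4_level j.+1) = (\sum_(x <- T4_level j) size (T4_children x))%N.
  by rewrite size_allpairs_dep sumnE big_map.
elim: k => [|k IH]; first by rewrite h big_seq1 size_T4_children eqxx.
rewrite h big_seq (eq_bigr (fun=> 3%N)) => [|x /T4_level_root x0].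
  by rewrite -big_seq big_const_seq count_predT iter_addn_0 IH expnS; lia.
by rewrite size_T4_children x0.
Qed.

(** Double counting: a vertex two levels up is reached once, from its parent, and a vertex of level
    [k] once from each of its children, four for the root and three otherwise. *)
Lemma sum_T4_level_nbrs (R : pzRingType) (F : T4_vertex -> R) k :
  \sum_(x <- T4_level k.+1) \sum_(a < 4) F (T4_nbr x a) =
  \sum_(x <- T4_level k.+2) F x +
  (if k is 0%N then 4 else 3)%:R * \sum_(x <- T4_level k) F x.
Proof.
under eq_bigr do rewrite sum_T4_nbrs.
rewrite big_split -sum_T4_levelS; congr (_ + _).
rewrite big_seq (eq_bigr (fun x => F (T4_parent x))); last first.
  by move=> x /T4_level_root ->.
rewrite -big_seq sum_T4_levelS mulr_sumr big_seq [RHS]big_seq.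
apply: eq_bigr => x xk.
rewrite big_seq (eq_bigr (fun=> F x)); last first.
  by move=> y /T4_parent_child ->.
rewrite -big_seq big_const_seq count_predT iter_addr_0 size_T4_children mulr_natl.
case: k xk => [|k] xk; last by rewrite (T4_level_root xk).
by move: xk; rewrite inE => ->.
Qed.

(** * Spectral inclusion and norm bound for the covering graph *)

Section GammaTildeSpectrum.
Variable R : realType.
Local Notation normc := (@Normc.normc R).
Local Notation H := (@laplace R GammaTilde (fun=> 1)).
(** The inverse square root of the branching number 3 of the tree; its powers normalize the sphere
    sums and define the Schur weight. *)
Let c : R := (Num.sqrt 3)^-1.

Let c_gt0 : 0 < c. Proof. by rewrite invr_gt0 sqrtr_gt0. Qed.

Let c2 : 3 * c ^+ 2 = 1.
Proof. by rewrite /c exprVn sqr_sqrtr // divff. Qed.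

(* The level sums [S k] of [f] satisfy [S (k + 2) + 3 S k = mu S (k + 1)], so
   [c ^ k S (k + 1)] is an elliptic recurrence, and it tends to 0 because
   level [k + 1] has [4 * 3 ^ k] vertices. *)
Lemma T4_no_green (f : T4_vertex -> R) (mu : R) : mu ^+ 2 <= 12 ->
  (\sum_(x <- T4_level k) f x ^+ 2) @[k --> \oo] --> (0 : R) ->
  ~ forall x, \sum_(a < 4) f (T4_nbr x a) = mu * f x + (x == T4_root)%:R.
Proof.
move=> mu12 f0 eqn; pose S k := \sum_(x <- T4_level k) f x.
have S0 : S 0%N = f T4_root by rewrite /S big_seq1.
have S1 : S 1%N = mu * S 0%N + 1.
  have := eqn T4_root; rewrite sum_T4_nbrs eqxx addr0 => e.
  by rewrite S0 -e /S sum_T4_levelS big_seq1.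
have rec k : S k.+2 + (if k is 0%N then 4 else 3)%:R * S k = mu * S k.+1.
  rewrite -sum_T4_level_nbrs mulr_sumr big_seq [RHS]big_seq.
  by apply: eq_bigr => x /T4_level_root x0; rewrite eqn x0 addr0.
pose v k := c ^+ k * S k.+1.
(* Cauchy-Schwarz over the 4 * 3^k vertices of level k + 1; the factor c^(2k) cancels 3^k. *)
have v2 k : v k ^+ 2 <= 4 * \sum_(x <- T4_level k.+1) f x ^+ 2.
  have : (\sum_(x <- T4_level k.+1) `|f x|) ^+ 2 <=
      (4 * 3 ^+ k) * \sum_(x <- T4_level k.+1) f x ^+ 2.
    have := weighted_CS (T4_level k.+1) (p := fun=> 1) (fun=> ltr01)
      (fun x => normr_ge0 (f x)).
    rewrite (_ : \sum_(x <- T4_level k.+1) 1 = 4 * 3 ^+ k); last first.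
      by rewrite big_const_seq count_predT iter_addr_0 size_T4_level natrM natrX.
    by under [X in _ * X]eq_bigr do rewrite divr1 real_normK ?num_real //.
  have : S k.+1 ^+ 2 <= (\sum_(x <- T4_level k.+1) `|f x|) ^+ 2.
    rewrite -[S k.+1 ^+ 2]real_normK ?num_real //.
    by rewrite ler_sqr ?nnegrE ?sumr_ge0 // ler_norm_sum.
  move=> h1 h2; have h := le_trans h1 h2; rewrite /v exprMn.
  have -> : 4 * \sum_(x <- T4_level k.+1) f x ^+ 2 =
      (c ^+ k) ^+ 2 * (4 * 3 ^+ k * \sum_(x <- T4_level k.+1) f x ^+ 2).
    have : (c ^+ k) ^+ 2 * 3 ^+ k = 1.
      by rewrite exprAC -exprMn mulrC c2 expr1n.
    move: ((c ^+ k) ^+ 2) (3 ^+ k) => p q pq.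
    by rewrite -[in LHS](mul1r 4) -pq; ring.
  by rewrite ler_wpM2l ?sqr_ge0.
have v0 : v @ \oo --> (0 : R).
  apply: (cvg0_sqr_le _ v2); rewrite [X in _ --> X](_ : 0 = 4 * 0);
    last by rewrite mulr0.
  apply: cvgM; first exact: cvg_cst.
  by have := f0; rewrite -cvg_shiftS.
have vrec k : v k.+2 = (c * mu) * v k.+1 - v k.
  have := rec k.+1 => /= e.
  have {e} -> : v k.+2 = c ^+ k.+2 * (mu * S k.+2 - 3 * S k.+1).
    by rewrite /v -e addrK.
  have : v k = 3 * c ^+ 2 * v k by rewrite c2 mul1r.
  by rewrite /v !exprS => ->; ring.
have cmu : (c * mu) ^+ 2 <= 4.
  by rewrite exprMn; have := sqr_ge0 c; have := c2; nra.
have v_eq0 := recurrence_elliptic cmu vrec v0.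
have SS k : S k.+1 = 0.
  by apply/eqP; have /eqP := v_eq0 k; rewrite /v mulf_eq0 expf_eq0 gt_eqF // andbF.
(* The vanishing of all later sums forces S 0 = 0 through the recurrence at the root, against S 1 =
   mu S 0 + 1. *)
have := rec 0%N; rewrite !SS mulr0 add0r => /eqP.
rewrite mulf_eq0 pnatr_eq0 /= => /eqP S00.
by move: S1; rewrite SS S00 mulr0 add0r => /eqP; rewrite eq_sym oner_eq0.
Qed.

Lemma GammaTilde_spectrum_real (x : R) : x ^+ 2 <= 169 / 12 ->
  spectrum H x%:C.
Proof.
move=> x2 [B [lB _ _] BP]; pose o : vertex GammaTilde := (T4_root, 0%N).
have ld := l2_delta R o.
have [e _] := BP _ ld; have lg := lB _ ld; move: (B _) lg e => g lg e {BP lB}.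
pose a y n := complex.Re (g (y, n)).
have a0 y : a y @ \oo --> (0 : R).
  exact: (@l2_Re_cvg0 _ _ g snd (fun n => (y, n)) lg (fun n => erefl n)).
have adj := adjE GammaTilde_in_uniq GammaTilde_inP.
have rec y n : a y n.+2 = x * a y n.+1 - a y n.
  have := congr1 (@^~ (y, n.+1)) e; rewrite !fctE /= adj.
  rewrite (sum_GammaTilde_inS g) /delta xpair_eqE andbF.
  move/(congr1 (@complex.Re R)); rewrite ReB ReD Re_mul_real -!/(a _ _) /= => h.
  by apply/eqP; rewrite -subr_eq0; apply/eqP; rewrite -[RHS]h; ring.
have eqn y : \sum_(b < 4) a (T4_nbr y b) 0%N + a y 1%N =
    x * a y 0%N + (y == T4_root)%:R.
  have := congr1 (@^~ (y, 0%N)) e; rewrite !fctE /= adj.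
  rewrite (sum_GammaTilde_in0 g) /delta xpair_eqE eqxx andbT.
  move/(congr1 (@complex.Re R)); rewrite ReB ReD Re_mul_real raddf_sum /= => h.
  apply/eqP; rewrite [X in _ == X]addrC -subr_eq.
  by apply/eqP; apply: etrans h _; case: eqP.
(* For |x| <= 2 the real part of [g] vanishes on every half-line, hence also on the tree, which
   contradicts the equation at the root. *)
have [x4|x4] := leP (x ^+ 2) 4.
  have z y := recurrence_elliptic x4 (rec y) (a0 y).
  have := eqn T4_root; rewrite !z mulr0 big1 => [|b _]; last exact: z.
  by rewrite eqxx !add0r => /eqP; rewrite eq_sym oner_eq0.
have [t [m [tm tm1 t1]]] := hyperbolic_roots x4.
have at1 y := recurrence_hyperbolic tm tm1 t1 (rec y) (a0 y).
apply: (@T4_no_green (fun y => a y 0%N) m).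
(* Here m^2 + 1/m^2 = x^2 - 2 <= 12 + 1/12 and m^2 > 1, so m^2 <= 12. *)
- have : t ^+ 2 * m ^+ 2 = 1 by rewrite -exprMn tm1 expr1n.
  have : x ^+ 2 = t ^+ 2 + m ^+ 2 + 2.
    by rewrite -tm sqrrD tm1; ring.
  have := sqr_ge0 t; have := sqr_ge0 m.
  move: (t ^+ 2) (m ^+ 2) (x ^+ 2) x2 t1 => T P X; nra.
(* The spheres of the tree, viewed in the covering graph, carry square sums of [g] that tend to
   0. *)
- pose s k := [seq (y, 0%N) : vertex GammaTilde | y <- T4_level k].
  have l1 k v : v \in s k -> T4_depth v.1 = k.
    by move=> /mapP[y yk ->] /=; exact: T4_level_depth.
  have u1 k : uniq (s k).
    by rewrite map_inj_uniq ?T4_level_uniq // => y1 y2 [].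
  have h := l2_decay lg u1 l1.
  apply: (squeeze_cvgr _ (cvg_cst 0) h); near=> k.
  rewrite big_map sumr_ge0 => [|y _]; last exact: sqr_ge0.
  by apply: ler_sum => y _; rewrite sqr_normcE lerDl sqr_ge0.
(* Substituting a y 1 = t a y 0 in the equation at [y] leaves the tree equation with parameter x - t
   = m. *)
- move=> y; apply/eqP; rewrite -(inj_eq (addIr (a y 1%N))) eqn at1 -tm.
  by apply/eqP; ring.
Unshelve. all: by end_near.
Qed.

Definition GammaTilde_weight (v : vertex GammaTilde) : R :=
  c ^+ T4_depth v.1 * (c / 2) ^+ v.2.

Lemma GammaTilde_weight_gt0 v : 0 < GammaTilde_weight v.
Proof. by rewrite mulr_gt0 // exprn_gt0 // divr_gt0. Qed.

(** The constant is 13 c / 2, and 1/c = 3 c. Along a half-line the ratio is 2/c + c/2 = 13 c / 2,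
    and at a tree vertex other than the root it is 3 c + 1/c + c/2, the same value. Only at the
    root, with 4 c + c/2, is the inequality strict. *)
Lemma GammaTilde_weight_le v :
  \sum_(e <- GammaTilde_in v) GammaTilde_weight (init e) <=
  13 * Num.sqrt 3 / 6 * GammaTilde_weight v.
Proof.
have -> : 13 * Num.sqrt 3 / 6 = 13 / 2 * c.
  have -> : Num.sqrt 3 = 3 * c.
    have s3 : Num.sqrt 3 != 0 :> R by rewrite gt_eqF // sqrtr_gt0.
    by apply: (mulIf s3); rewrite -expr2 sqr_sqrtr // mulfVK.
  by field.
case: v => x [|n]; last first.
  rewrite sum_GammaTilde_inS /GammaTilde_weight /= !exprS le_eqVlt.
  apply/orP; left; apply/eqP.
  set p := c ^+ _; set q := (c / 2) ^+ n.
  have -> : p * q = 3 * c ^+ 2 * (p * q) by rewrite c2 mul1r.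
  by field.
rewrite (sum_GammaTilde_in0 GammaTilde_weight) /GammaTilde_weight /= expr0 expr1.
rewrite (sum_T4_nbrs (fun y => c ^+ T4_depth y * 1)).
rewrite (_ : \sum_(y <- T4_children x) _ =
    (size (T4_children x))%:R * c ^+ (T4_depth x).+1); last first.
  rewrite big_seq (eq_bigr (fun=> c ^+ (T4_depth x).+1)).
    by rewrite -big_seq big_const_seq count_predT iter_addr_0 mulr_natl.
  by move=> y /T4_depth_child ->; rewrite mulr1.
rewrite size_T4_children; case: eqVneq => [->|/T4_depth_parent <-].
  by rewrite /T4_depth /= expr1 expr0 addr0; have := c_gt0; lra.
rewrite !exprS; move: (c ^+ T4_depth (T4_parent x)) => p.
have -> : p * 1 = 3 * c ^+ 2 * p by rewrite c2 mul1r mulr1.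
by rewrite le_eqVlt; apply/orP; left; apply/eqP; field.
Qed.

Lemma GammaTilde_resolvent z :
  complex.Im z != 0 \/ 13 * Num.sqrt 3 / 6 < normc z -> resolvent_set H z.
Proof.
apply: (adj_resolvent GammaTilde_in_uniq GammaTilde_inP
  GammaTilde_weight_gt0 _ GammaTilde_weight_le).
by rewrite divr_ge0 // mulr_ge0 // sqrtr_ge0.
Qed.

End GammaTildeSpectrum.

(** * Both spectra and their comparison *)

Theorem theorem42 (R : realType) :
  [/\ spectrum (@laplace R Gamma (fun=> 1)) =
        (fun x : R => x%:C) @` (`[-2, 2] `|` [set 17 / 4]),
      spectrum (@laplace R GammaTilde (fun=> 1)) =
        (fun x : R => x%:C) @`
          `[- (13 * Num.sqrt 3 / 6), 13 * Num.sqrt 3 / 6]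
    & ~ (spectrum (@laplace R Gamma (fun=> 1)) `<=`
         spectrum (@laplace R GammaTilde (fun=> 1)))].
Proof.
have sqM : (13 * Num.sqrt 3 / 6) ^+ 2 = 169 / 12 :> R.
  have : (Num.sqrt 3 : R) ^+ 2 = 3 by rewrite sqr_sqrtr.
  by move: (Num.sqrt 3) => s s3; rewrite !exprMn s3; field.
have M0 : 0 <= 13 * Num.sqrt 3 / 6 :> R.
  by rewrite divr_ge0 // mulr_ge0 // sqrtr_ge0.
(* Only the sign and the square of the constant are kept, so that the remaining comparisons are
   polynomial. *)
move: (13 * Num.sqrt 3 / 6) sqM M0 (@GammaTilde_resolvent R) => M sqM M0 resM.
have large (z : R[i]) (N : R) : ~ (complex.Im z != 0 \/ N < Normc.normc z) ->
    exists2 x : R, `[- N, N]%classic x & x%:C = z.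
  move=> h; exists (complex.Re z).
    rewrite /= in_itv /= -ler_norml leNgt; apply/negP => Nz; apply: h; right.
    exact: lt_le_trans (Re_le_normc z).
  have [z0|z0] := eqVneq (complex.Im z) 0; last by case: h; left.
  by move: z0; case: (z) => a b /= ->.
have sG : spectrum (@laplace R Gamma (fun=> 1)) =
    (fun x : R => x%:C) @` (`[-2, 2] `|` [set 17 / 4]).
  apply/seteqP; split=> [z Sz|_ [x xG <-]].
  - have [z17|z17] := eqVneq z (17 / 4).
      exists (17 / 4); first by right.
      by rewrite z17 rmorphM fmorphV !rmorph_nat.
    have [|x x2 xz] := large z 2; last by exists x => //; left.
    by move=> z2; apply: Sz; exact: Gamma_resolvent.
  - apply: Gamma_spectrum_real; case: xG => [|->]; last by right.
    by rewrite /= in_itv /= => /andP[x1 x2]; left; nra.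
have sT : spectrum (@laplace R GammaTilde (fun=> 1)) =
    (fun x : R => x%:C) @` `[- M, M].
  apply/seteqP; split=> [z Sz|_ [x + <-]].
    by apply: large => zM; apply: Sz; exact: resM.
  rewrite /= in_itv /= => xM; apply: GammaTilde_spectrum_real; rewrite -sqM.
  nra.
(* The point 17/4 separates the spectra: its square 289/16 exceeds 169/12. *)
split=> //; rewrite sG sT => /(_ (17 / 4)%:C) [|x + [x17]].
  by exists (17 / 4) => //; right.
by rewrite /= in_itv /= x17 => /andP[_ h]; nra.
Qed.
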